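(* For every $a\in\Gamma$, the function $h_a$ defined for $z\in K\cap\mathbb{Z}^2$ by $$h_a(z)=\begin{cases} (z\cdot f_i)\,e^{a\cdot z}-\mathbb{E}_z\big[(f_i\cdot S(\tau))\,e^{a\cdot S(\tau)},\ \tau<\infty\big], & \text{if } q(a)=c_i,\ i=1,2,\\[2pt] e^{a\cdot z}-\mathbb{E}_z\big[e^{a\cdot S(\tau)},\ \tau<\infty\big], & \text{if } q(a)\in \mathrm{int}(\Sigma),\end{cases}$$ is strictly positive on $K\cap\mathbb{Z}^2$ and harmonic for the random walk killed when leaving $K$, i.e. $\mathbb{E}_z[h_a(S(1)),\ \tau>1]=h_a(z)$ for all $z\in K\cap\mathbb{Z}^2$.
   Context: Cone: $c_1,c_2\in\mathbb{S}^1\subset\mathbb{R}^2$ are two unit vectors with angle between them in $(0,\pi)$; $K$ is the interior of the convex cone with vertex $0$ formed by the rays from $0$ through the circular sector of $\mathbb{S}^1$ between $c_1$ and $c_2$. For $i=1,2$, $f_i$ is the unit vector perpendicular to $c_i$ pointing into the cone, so that $K=\{z\in\mathbb{R}^2: z\cdot f_1>0,\ z\cdot f_2>0\}$. Random walk: $S(n)=(S_1(n),S_2(n))$ is a random walk on $\mathbb{Z}^2$ with i.i.d. steps distributed according to a probability $\gamma$ on $\mathbb{Z}^2$; $\mathbb{P}_z,\mathbb{E}_z$ denote probability and expectation for the walk started at $S(0)=z$. Notation: $\mathbb{E}_z[X,A]=\mathbb{E}_z[X\mathbf 1_A]$. Standing assumptions: (A1) $S(n)$ is irreducible on $\mathbb{Z}^2$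 and $m=\sum_{z}z\gamma(z)\neq 0$; (A2) the random walk killed when leaving $K$ is irreducible in $K$ (i.e. on $K\cap\mathbb{Z}^2$); (A3) $\varphi(a)=\sum_{z\in\mathbb{Z}^2}\gamma(z)e^{a\cdot z}$ is finite for every $a\in\mathbb{R}^2$; (A4) for $i=1,2$, $f_i\cdot S(n)$ is an aperiodic random walk on the additive group $f_i\cdot\mathbb{Z}^2=\{f_i\cdot w: w\in\mathbb{Z}^2\}\subset\mathbb{R}$. Under these assumptions it is well known that $D=\{a\in\mathbb{R}^2:\varphi(a)\le 1\}$ is compact and strictly convex, $\nabla\varphi$ does not vanish on $\partial D=\{a:\varphi(a)=1\}$, and $a\mapsto q(a)=\nabla\varphi(a)/|\nabla\varphi(a)|$ is a homeomorphism from $\partial D$ onto $\mathbb{S}^1$. Let $\Sigma=\mathrm{cl}(K)\cap\mathbb{S}^1$ (with $\mathrm{int}(\Sigma)=K\cap\mathbb{S}^1$ its interior in $\mathbb{S}^1$), $\Gamma=\{a\in\partial D: q(a)\in\Sigma\}$, and $\tau=\inf\{n\ge 0: S(n)\notin K\}$. *)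

(* Defs.v *)
From HB Require Import structures.
From mathcomp Require Import all_boot all_order all_algebra.
From mathcomp Require Import all_classical all_reals all_analysis.

Set Implicit Arguments.
Unset Strict Implicit.
Unset Printing Implicit Defensive.

Import Order.TTheory GRing.Theory Num.Theory.
Import numFieldNormedType.Exports.

Local Open Scope classical_set_scope.
Local Open Scope ring_scope.

(* The alias carries the discrete sigma-algebra, so that a probability on
   lattice is determined by its masses and integrals against it are sums. *)
Definition lattice : Type := (int * int)%type.

HB.instance Definition _ := GRing.Zmodule.on lattice.
HB.instance Definition _ := isPointed.Build lattice (0, 0).
HB.instance Definition _ := @isMeasurable.Build default_measure_display
  lattice discrete_measurable discrete_measurable0
  discrete_measurableC discrete_measurableU.

Section plane.
Context {R : realType}.
Implicit Types u v c f : R * R.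

Definition embed (z : lattice) : R * R := (z.1%:~R, z.2%:~R).

Definition dot u v : R := u.1 * v.1 + u.2 * v.2.

(* The norm `|_| of R * R is the sup norm, hence a separate Euclidean norm. *)
Definition enorm u : R := Num.sqrt (dot u u).

Definition unit_circle : set (R * R) := [set u | enorm u = 1].

Definition angle u v : R := acos (dot u v / (enorm u * enorm v)).

(* When the angle between c1 and c2 is in (0, pi), the sector between them
   consists of the unit vectors that are nonnegative combinations of both. *)
Definition sector c1 c2 : set (R * R) :=
  [set u | unit_circle u /\
    exists s t : R, [/\ 0 <= s, 0 <= t & u = s *: c1 + t *: c2]].

Definition open_cone c1 c2 : set (R * R) :=
  interior [set v | exists r : R, exists2 u, sector c1 c2 u & 0 <= r /\ v = r *: u].

Definition inward_normal (K : set (R * R)) c f : Prop :=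
  [/\ unit_circle f, dot f c = 0 & \forall e \near 0^'+, K (c + e *: f)].

Definition topological_boundary (A : set (R * R)) : set (R * R) :=
  closure A `\` interior A.

Definition gradient (F : R * R -> R) (a : R * R) : R * R :=
  ('D_(1, 0) F a, 'D_(0, 1) F a).

Definition Sigma (K : set (R * R)) : set (R * R) := closure K `&` unit_circle.

Definition int_Sigma (K : set (R * R)) : set (R * R) := K `&` unit_circle.

End plane.

Section step_law.
Context {R : realType} (gamma : probability lattice R).

Definition drift : R * R :=
  (\int[gamma]_z (embed z).1, \int[gamma]_z (embed z).2).

Definition phi_ext (a : R * R) : \bar R :=
  (\int[gamma]_z (expR (dot a (embed z)))%:E)%E.

Definition phi (a : R * R) : R := fine (phi_ext a).

Definition phi_sublevel : set (R * R) := [set a | phi a <= 1].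

Definition q (a : R * R) : R * R :=
  (enorm (gradient phi a))^-1 *: gradient phi a.

Definition Gamma (K : set (R * R)) : set (R * R) :=
  [set a | topological_boundary phi_sublevel a /\ Sigma K (q a)].

End step_law.

Section random_walk.
Context {R : realType} {d : measure_display} {Omega : measurableType d}.
Context (P : probability Omega R) (X : nat -> {RV P >-> lattice}).

Definition iid_steps (gamma : probability lattice R) : Prop :=
  (forall k (A : set lattice), distribution P (X k) A = gamma A) /\
  (forall (s : seq nat) (A : nat -> set lattice), uniq s ->
    P (\bigcap_(k in [set` s]) (X k @^-1` A k)) =
    (\prod_(k <- s) P (X k @^-1` A k))%E).

Definition walk (z : lattice) (n : nat) (w : Omega) : lattice :=
  z + \sum_(k < n) X k w.

Definition irreducible_walk : Prop :=
  forall x y : lattice, exists n, (0 < P [set w | walk x n w = y])%E.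

(* The walk f . S(n) on the group f . Z^2: the period of each of its states
   f . x, i.e. the gcd of its possible return times, is 1. *)
Definition aperiodic_projection (f : R * R) : Prop :=
  forall (x : lattice) (p : nat),
    (forall n, (0 < n)%N ->
      (0 < P [set w | dot f (embed (walk x n w)) = dot f (embed x)])%E ->
      (p %| n)%N) ->
    p = 1%N.

Section killed.
Variable K : set (R * R).

Definition tau (z : lattice) (w : Omega) : \bar R :=
  ereal_inf [set n%:R%:E | n in [set n : nat | ~ K (embed (walk z n w))]].

Definition walk_tau (z : lattice) (w : Omega) : lattice :=
  walk z (Num.truncn (fine (tau z w))) w.

Definition exits (z : lattice) : set Omega := [set w | (tau z w < +oo)%E].

Definition killed_irreducible : Prop :=
  forall x y : lattice, K (embed x) -> K (embed y) ->
    exists n, (0 < P [set w | walk x n w = y /\ (n%:R%:E < tau x w)%E])%E.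

(* The extended-real integral of a function that is nonnegative on K: being
   equal to a finite value includes integrability. *)
Definition killed_harmonic (h : lattice -> R) : Prop :=
  forall z : lattice, K (embed z) ->
    (\int[P]_(w in [set w | (1 < tau z w)%E]) (h (walk z 1 w))%:E)%E = (h z)%:E.

Variables (gamma : probability lattice R) (c1 c2 f1 f2 : R * R).

(* The last branch is never reached for a in Gamma. *)
Definition weight (a : R * R) (x : lattice) : R :=
  if q gamma a == c1 then dot (embed x) f1 * expR (dot a (embed x))
  else if q gamma a == c2 then dot (embed x) f2 * expR (dot a (embed x))
  else if `[< int_Sigma K (q gamma a) >] then expR (dot a (embed x))
  else 0.

Definition h (a : R * R) (z : lattice) : R :=
  weight a z - \int[P]_(w in exits z) weight a (walk_tau z w).

End killed.
End random_walk.

(* Main.v *)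
Require Import Defs.
From HB Require Import structures.
From mathcomp Require Import all_boot all_order all_algebra.
From mathcomp Require Import all_classical all_reals all_analysis.
From mathcomp Require Import measurable_realfun ring lra.

(** Write [w] for the weight attached to [a] and [D] for the lattice points of
the cone.  On all of [D], [w] is positive and harmonic for the free walk: since
[phi a = 1], the exponential [e^{a.z}] is harmonic, and when [q a = c_i] the
factor [z.f_i] may be added because the mean of the tilted step law, which is
the gradient of [phi] at [a], is parallel to [c_i] and hence orthogonal to
[f_i].  So [h_a z] is the defect between [w z] and the mean of [w] at the exit
point, and it is harmonic for the killed walk by first-step analysis as soon as
the means at exit of the positive and negative parts of [w] are finite.

Every estimate comes from one principle ([exit_mean_le]): the mean at exit of
[F >= 0] is the least nonnegative solution [V] of the inequality
[E_z[V(S(1)); S(1) in D] + E_z[F(S(1)); S(1) notin D] <= V z].  In particular a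
nonnegative function that is superharmonic for the free walk on [D] and
dominates [F] off [D] bounds the mean at exit of [F]
([superharmonic_exit_bound]).  It is applied as follows:

- [h_a >= 0], because [w + E[w^-(S(tau))]] solves the inequality for [F = w^+]
  ([exit_defect_ge0]);
- if [q a] is interior, [e^{(a - t f_1).z} + e^{(a - s f_2).z}] is
  superharmonic for some small [t, s > 0], since [phi] decreases at [a] in the
  directions [- f_i] ([interior_bounds]);
- if [q a = c_1], the part of [w^+] off the cone lives where [z.f_2 <= 0], and
  a multiple of [e^{(a + v).z}] bounds it, where [v = t (alpha f_1 - beta f_2)]
  with [alpha, beta > 0] is again a direction of descent of [phi]
  ([boundary_positive_part]);
- if [q a = c_1], the mean of [w^-] is an expected overshoot of the centred walk
  [f_1.S(n)] below [0]; it is controlled by [e^{a.z} u(z.f_1)] with [u] bounded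
  and concave on the positive axis, equal to the overshoot on the negative axis
  ([boundary_negative_part]).

The bounds on the mean of [w^+] show [h_a (k z) > 0] for every [z] in [D] and
all large [k].  Irreducibility of the killed walk carries this positivity from
[k z] back to [z] ([exit_defect_gt0]).

The link with the random walk is made once, by the Markov property
([past_step_integral]): survival probabilities and means at exit equal iterates
of the one-step kernel ([alive_integral], [exits_integral]), after which the
argument only involves functions on the lattice. *)

Set Implicit Arguments.
Unset Strict Implicit.
Unset Printing Implicit Defensive.

Import Order.TTheory GRing.Theory Num.Theory.
Import numFieldNormedType.Exports.

Local Open Scope classical_set_scope.
Local Open Scope ring_scope.

(** * The killed kernel and its exit means *)

Section killed_kernel.
Local Open Scope ereal_scope.
Context {R : realType} (gamma : probability lattice R) (D : set lattice).
Implicit Types (x : lattice) (F G V : lattice -> \bar R).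

Definition step_mean F x : \bar R := \int[gamma]_y F (x + y)%R.

(** The transition operator of the walk killed on leaving [D]. *)
Definition killed_mean F : lattice -> \bar R := step_mean (F \_ D).

Definition escape_mean F : lattice -> \bar R := step_mean (F \_ (~` D)).

(** For [x] in [D] this is the mean of [F] at the exit point of [D], on the event
that the walk started at [x] exits: the [n]-th term accounts for an exit at time
[n + 1]. *)
Definition exit_mean F x : \bar R :=
  \sum_(n <oo) iter n killed_mean (escape_mean F) x.

Lemma step_mean_ge0 F x : (forall y, 0 <= F y) -> 0 <= step_mean F x.
Proof. by move=> F0; apply: integral_ge0 => y _. Qed.

Lemma step_mean_le F G x : (forall y, 0 <= F y) -> (forall y, F y <= G y) ->
  step_mean F x <= step_mean G x.
Proof.
move=> F0 FG; apply: ge0_le_integral => //.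
Qed.

Lemma step_meanD F G x : (forall y, 0 <= F y) -> (forall y, 0 <= G y) ->
  step_mean (fun y => F y + G y) x = step_mean F x + step_mean G x.
Proof.
by move=> F0 G0; rewrite /step_mean ge0_integralD.
Qed.

Lemma killed_mean_ge0 F x : (forall y, D y -> 0 <= F y) ->
  0 <= killed_mean F x.
Proof. by move=> F0; apply: step_mean_ge0 => y; apply: erestrict_ge0. Qed.

Lemma escape_mean_ge0 F x : (forall y, 0 <= F y) -> 0 <= escape_mean F x.
Proof. by move=> F0; apply: step_mean_ge0 => y; apply: erestrict_ge0. Qed.

Lemma killed_mean_le F G x : (forall y, D y -> 0 <= F y) ->
  (forall y, D y -> F y <= G y) -> killed_mean F x <= killed_mean G x.
Proof.
move=> F0 FG; apply: step_mean_le => y; first exact: erestrict_ge0.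
exact: lee_restrict.
Qed.

Lemma eq_killed_mean F G x : (forall y, D y -> F y = G y) ->
  killed_mean F x = killed_mean G x.
Proof.
move=> FG; congr (step_mean _ x); apply/eq_restrictP => y /set_mem; exact: FG.
Qed.

Lemma killed_meanD F G x :
  (forall y, D y -> 0 <= F y) -> (forall y, D y -> 0 <= G y) ->
  killed_mean (fun y => F y + G y) x = killed_mean F x + killed_mean G x.
Proof.
move=> F0 G0; rewrite /killed_mean erestrictD step_meanD// => y;
  exact: erestrict_ge0.
Qed.

Lemma step_mean_split F x : (forall y, 0 <= F y) ->
  step_mean F x = killed_mean F x + escape_mean F x.
Proof.
move=> F0; rewrite -step_meanD; [|by move=> y; exact: erestrict_ge0..].
apply: eq_integral => y _; rewrite !patchE in_setC.
by case: (_ \in D); rewrite ?adde0 ?add0e.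
Qed.

Lemma iter_killed_mean_ge0 n F x : (forall y, 0 <= F y) ->
  0 <= iter n killed_mean F x.
Proof.
by move=> F0; elim: n x => [//|n IH] x /=; exact: killed_mean_ge0.
Qed.

Lemma exit_mean_ge0 F x : (forall y, 0 <= F y) -> 0 <= exit_mean F x.
Proof.
move=> F0; apply: nneseries_ge0 => n _ _; apply: iter_killed_mean_ge0.
by move=> y; exact: escape_mean_ge0.
Qed.

Lemma killed_mean_sum (f : nat -> lattice -> \bar R) N x :
  (forall n y, 0 <= f n y) ->
  killed_mean (fun y => \sum_(0 <= n < N) f n y) x =
  \sum_(0 <= n < N) killed_mean (f n) x.
Proof.
move=> f0; elim: N => [|N IH].
  rewrite big_geq// -[RHS](integral0 gamma setT); apply: eq_integral => y _.
  by rewrite patchE; case: ifP => // _; rewrite big_geq.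
rewrite big_nat_recr//= -IH -killed_meanD//; last first.
  by move=> y _; exact: sume_ge0.
by apply: eq_killed_mean => y _; rewrite big_nat_recr.
Qed.

(** First-step analysis: the walk leaves [D] at its first step, or it starts afresh
from its first position. *)
Lemma exit_meanE F x : (forall y, 0 <= F y) ->
  exit_mean F x = escape_mean F x + killed_mean (exit_mean F) x.
Proof.
move=> F0; have i0 n y : 0 <= iter n killed_mean (escape_mean F) y.
  by apply: iter_killed_mean_ge0 => z; exact: escape_mean_ge0.
rewrite {1}/exit_mean nneseries_recl//; congr (_ + _).
rewrite -nneseries_addn//.
transitivity (\int[gamma]_y
    \sum_(n <oo) ((iter n killed_mean (escape_mean F)) \_ D) (x + y)%R).
  rewrite integral_nneseries//; last by move=> n y _; exact: erestrict_ge0.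
  by apply: eq_eseriesr => n _; rewrite addn1.
apply: eq_integral => y _; rewrite patchE; case: ifPn => xD.
  by apply: eq_eseriesr => n _; rewrite patchE xD.
by rewrite eseries0// => n _ _; rewrite patchE (negbTE xD).
Qed.

(** Minimality of the mean at exit among the nonnegative supersolutions of the
equation of [exit_meanE]: the contribution of the exits up to any finite time
stays below a supersolution, by induction on that time. *)
Lemma exit_mean_le F V : (forall y, 0 <= F y) -> (forall y, D y -> 0 <= V y) ->
  (forall x, D x -> escape_mean F x + killed_mean V x <= V x) ->
  forall x, D x -> exit_mean F x <= V x.
Proof.
move=> F0 V0 FV; have i0 n y : 0 <= iter n killed_mean (escape_mean F) y.
  by apply: iter_killed_mean_ge0 => z; exact: escape_mean_ge0.
have bound N x : D x ->
    \sum_(0 <= n < N) iter n killed_mean (escape_mean F) x <= V x.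
  elim: N x => [|N IH] x Dx; first by rewrite big_geq// V0.
  rewrite big_nat_recl//; apply: le_trans (FV _ Dx); rewrite leeD2l//.
  rewrite -killed_mean_sum//; apply: killed_mean_le => y Dy; last exact: IH.
  by apply: sume_ge0 => n _; exact: i0.
move=> x Dx; apply: lime_le; first exact: is_cvg_nneseries.
by apply: nearW => N; exact: bound.
Qed.

End killed_kernel.

(** * Positivity and harmonicity of the defect at exit *)

Section harmonic_defect.
Local Open Scope ereal_scope.
Context {R : realType} (gamma : probability lattice R) (D : set lattice).
Variable w : lattice -> R.
Let Wp := (EFin \o w)^\+.
Let Wn := (EFin \o w)^\-.

(** Positive and negative parts are treated apart because [exit_mean] is only
meaningful on nonnegative functions. *)
Definition exit_defect x : R :=
  (w x - (fine (exit_mean gamma D Wp x) - fine (exit_mean gamma D Wn x)))%R.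

Hypothesis w_gt0 : forall x, D x -> (0 < w x)%R.
Hypothesis w_mean : forall x, D x ->
  step_mean gamma Wp x = (w x)%:E + step_mean gamma Wn x.
Hypothesis Wp_fin : forall x, D x -> exit_mean gamma D Wp x < +oo.
Hypothesis Wn_fin : forall x, D x -> exit_mean gamma D Wn x < +oo.

Let Wp0 x : 0 <= Wp x. Proof. exact: funepos_ge0. Qed.
Let Wn0 x : 0 <= Wn x. Proof. exact: funeneg_ge0. Qed.

Let WpD x : D x -> Wp x = (w x)%:E.
Proof. by move=> /w_gt0/ltW x0; rewrite /Wp funeposE /= max_l// lee_fin. Qed.

Let WnD x : D x -> Wn x = 0.
Proof. by move=> /w_gt0/ltW x0; rewrite /Wn funenegE /= max_r// lee_fin oppr_le0. Qed.

Let killed_Wn x : killed_mean gamma D Wn x = 0.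
Proof.
rewrite -(integral0 gamma setT); apply: eq_integral => y _.
by rewrite patchE; case: ifP => // /set_mem/WnD.
Qed.

Let Up_fin x : D x -> exit_mean gamma D Wp x \is a fin_num.
Proof. by move=> Dx; rewrite ge0_fin_numE ?Wp_fin// exit_mean_ge0. Qed.
Let Un_fin x : D x -> exit_mean gamma D Wn x \is a fin_num.
Proof. by move=> Dx; rewrite ge0_fin_numE ?Wn_fin// exit_mean_ge0. Qed.

Let V x := (w x)%:E + exit_mean gamma D Wn x.

Let V0 x : D x -> 0 <= V x.
Proof. by move=> Dx; rewrite adde_ge0 ?exit_mean_ge0// lee_fin ltW ?w_gt0. Qed.

Let V_eq x : D x -> V x = escape_mean gamma D Wp x + killed_mean gamma D V x.
Proof.
move=> Dx; rewrite killed_meanD; last 2 first.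
- by move=> y Dy; rewrite lee_fin ltW ?w_gt0.
- by move=> y _; exact: exit_mean_ge0.
have -> : killed_mean gamma D (EFin \o w) x = killed_mean gamma D Wp x.
  by apply: eq_killed_mean => y /WpD.
rewrite addeA [_ + killed_mean _ _ Wp x]addeC -step_mean_split// w_mean//.
rewrite (step_mean_split _ D _ Wn0)// killed_Wn add0e -addeA; congr (_ + _).
by rewrite -exit_meanE.
Qed.

Let defectE x : D x -> (exit_defect x)%:E + exit_mean gamma D Wp x = V x.
Proof.
move=> Dx; rewrite /V /exit_defect; move: (Up_fin Dx) (Un_fin Dx).
move: (exit_mean _ _ Wp x) (exit_mean _ _ Wn x) => [u||] [v||]//= _ _.
by rewrite -!EFinD opprB addrA subrK.
Qed.

(** [V] solves the first-step equation for [Wp], so it dominates the least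
solution [exit_mean gamma D Wp]. *)
Lemma exit_defect_ge0 x : D x -> (0 <= exit_defect x)%R.
Proof.
move=> Dx; rewrite -lee_fin -(leeD2rE _ _ (Up_fin Dx)) add0e defectE//.
by apply: exit_mean_le => // y Dy; rewrite -V_eq.
Qed.

(** [V] and [exit_mean gamma D Wp] solve the same affine equation with the same
source [escape_mean gamma D Wp]; their difference solves the homogeneous one. *)
Lemma exit_defect_harmonic x : D x ->
  killed_mean gamma D (EFin \o exit_defect) x = (exit_defect x)%:E.
Proof.
move=> Dx.
suff eqD : killed_mean gamma D (EFin \o exit_defect) x + exit_mean gamma D Wp x
    = (exit_defect x)%:E + exit_mean gamma D Wp x.
  by apply/eqP; rewrite eq_le; apply/andP; split;
    rewrite -(leeD2rE _ _ (Up_fin Dx)) eqD.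
rewrite defectE// V_eq// exit_meanE// addeCA; congr (_ + _).
rewrite -killed_meanD; last 2 first.
- by move=> y Dy; rewrite lee_fin exit_defect_ge0.
- by move=> y _; exact: exit_mean_ge0.
by apply: eq_killed_mean => y Dy; rewrite -defectE.
Qed.

(** The bound at [z] makes the defect positive there; harmonicity, iterated [n]
times, bounds the defect at [x] below by a positive multiple of it. *)
Lemma exit_defect_gt0 n x z : D x -> D z ->
  exit_mean gamma D Wp z < (w z)%:E ->
  0 < iter n (killed_mean gamma D) (fun y => (y == z)%:R%:E) x ->
  (0 < exit_defect x)%R.
Proof.
move=> Dx Dz zlt it0.
have hz : (0 < exit_defect z)%R.
  rewrite -lte_fin -(lteD2rE _ _ (Up_fin Dz)) add0e defectE//.
  by rewrite (lt_le_trans zlt)// leeDl// exit_mean_ge0.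
rewrite -lte_fin; apply: (@lt_le_trans _ _ ((exit_defect z)%:E *
  iter n (killed_mean gamma D) (fun y => (y == z)%:R%:E) x)).
  by rewrite mule_gt0// lte_fin.
elim: n x Dx {it0} => [|n IH] x Dx /=.
  case: eqP => [->|_]; first by rewrite mule1.
  by rewrite mule0 lee_fin exit_defect_ge0.
rewrite -[leRHS]exit_defect_harmonic//.
rewrite /killed_mean /step_mean -ge0_integralZl//; last 2 first.
- move=> y _; apply: erestrict_ge0 => u Du; apply: iter_killed_mean_ge0 => v.
  by rewrite lee_fin ler0n.
- by rewrite lee_fin ltW.
apply: ge0_le_integral => //.
- move=> y _; apply: mule_ge0; first by rewrite lee_fin ltW.
  apply: erestrict_ge0 => u Du; apply: iter_killed_mean_ge0 => v.
  by rewrite lee_fin ler0n.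
- by move=> y _; rewrite !patchE; case: ifP => [/set_mem/IH//|]; rewrite mule0.
Qed.

End harmonic_defect.

(** * The Markov property of a walk with i.i.d. steps *)

Section fibers.
Local Open Scope ereal_scope.
Context d (Omega : measurableType d) (R : realType).

(** The restricted measure gives no mass to the complement of [E]. *)
Lemma ge0_integral_mrestr (mu : {measure set Omega -> \bar R}) (E : set Omega)
    (mE : measurable E) (f : Omega -> \bar R) :
  measurable_fun [set: Omega] f -> (forall w, 0 <= f w) ->
  \int[mrestr mu mE]_w f w = \int[mu]_(w in E) f w.
Proof.
move=> mf f0; rewrite -(setUv E) ge0_integral_setU//; last 3 first.
- exact: measurableC.
- by rewrite setUv.
- exact/disj_setPCl.
rewrite [X in _ + X](_ : _ = 0) ?adde0; last first.
  rewrite -(@integral_measure_zero _ _ R (~` E) f).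
  by apply: eq_measure_integral => A mA AE; rewrite /= /mrestr (_ : _ `&` _ = set0)
    ?measure0// -subset0 => x [/AE].
by apply: eq_measure_integral => A mA AE; rewrite /= /mrestr setIidl.
Qed.

Lemma measurable_countable_fibers (T : countType) (Y : Omega -> T) :
  (forall t, measurable [set w | Y w = t]) ->
  forall B : set T, measurable (Y @^-1` B).
Proof.
move=> mY B.
rewrite (_ : _ @^-1` _ = \bigcup_(k in [set: nat])
    (if unpickle k is Some t then [set w | Y w = t /\ B t] else set0)).
  apply: bigcup_measurable => k _; case: unpickle => [t|//].
  have [Bt|nBt] := pselect (B t).
    by rewrite (_ : [set w | _] = [set w | Y w = t])//; apply/seteqP; split => w // [].
  by rewrite (_ : [set w | _] = set0)//; apply/seteqP; split => w // [].
apply/seteqP; split => [w BYw|w [k _]].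
  by exists (pickle (Y w)) => //; rewrite pickleK.
by case: unpickle => // t [<-].
Qed.

Lemma ge0_integral_countable_fibers (P : {measure set Omega -> \bar R})
    (T : countType) (Y : Omega -> T) (f : Omega -> \bar R) :
  (forall t, measurable [set w | Y w = t]) ->
  measurable_fun [set: Omega] f -> (forall w, 0 <= f w) ->
  \int[P]_w f w = \sum_(k <oo) \int[P]_(w in [set w | pickle (Y w) = k]) f w.
Proof.
move=> mY mf f0.
have E : [set: Omega] = \bigcup_k [set w | pickle (Y w) = k].
  by apply/seteqP; split => // w _; exists (pickle (Y w)).
rewrite [in LHS]E ge0_integral_bigcup//.
- by move=> k; apply: (measurable_countable_fibers mY [set t | pickle t = k]).
- by rewrite -E.
- by move=> i j _ _ [w [<- <-]].
Qed.

End fibers.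

Section markov.
Local Open Scope ereal_scope.
Context {R : realType} {d : measure_display} {Omega : measurableType d}.
Context (P : probability Omega R) (X : nat -> {RV P >-> lattice}).
Variable gamma : probability lattice R.
Hypothesis hX : iid_steps X gamma.

(** The history up to time [n] takes values in a countable type, so that
conditioning on it is a sum over its fibers. *)
Definition steps n w : seq (int * int) := [seq X k w | k <- iota 0 n].

(** Measurability with respect to the first [n] steps, phrased without a sigma-algebra:
the history is discrete, so any function of it is measurable
(see [past_measurable]). *)
Definition past {T : Type} n (f : Omega -> T) :=
  forall w w', (forall k, (k < n)%N -> X k w = X k w') -> f w = f w'.

Lemma steps_eqP n w w' :
  steps n w = steps n w' <-> (forall k, (k < n)%N -> X k w = X k w').
Proof.
rewrite /steps; split => [/eq_in_map e k kn|e].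
  by apply: e; rewrite mem_iota.
by apply/eq_in_map => k; rewrite mem_iota => /andP[_ kn]; exact: e.
Qed.

Lemma steps_fiber n w0 : [set w | steps n w = steps n w0] =
  \bigcap_(k in [set` iota 0 n]) (X k @^-1` [set X k w0]).
Proof.
apply/seteqP; split => [w /steps_eqP e k /=|w e].
  by rewrite mem_iota => /andP[_ kn]; exact: e.
by apply/steps_eqP => k kn; apply: e; rewrite /= mem_iota.
Qed.

Lemma measurable_steps_fiber n s : measurable [set w | steps n w = s].
Proof.
have [[w0 <-]|h] := pselect (exists w0, steps n w0 = s); last first.
  rewrite (_ : [set w | _] = set0)//; apply/seteqP; split => // w /= e.
  by apply: h; exists w.
rewrite steps_fiber bigcap_seq; apply: big_rec => // k A _ mA.
by apply: measurableI => //; exact: measurable_funPTI.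
Qed.

Lemma past_measurable {d'} {T : measurableType d'} n (f : Omega -> T) :
  past n f -> measurable_fun [set: Omega] f.
Proof.
move=> fn _ B mB; rewrite setTI.
rewrite (_ : f @^-1` B = steps n @^-1` (steps n @` (f @^-1` B))).
  exact: (measurable_countable_fibers (@measurable_steps_fiber n)).
apply/seteqP; split => [w ?|w [w' Bfw' /steps_eqP/fn e]]; first by exists w.
by rewrite /= -e.
Qed.

(** Fixing the first [n] steps is a product event, and so is its intersection with
an event on the next step. *)
Lemma steps_indep n w0 (C : set lattice) :
  P ([set w | steps n w = steps n w0] `&` X n @^-1` C) =
  P [set w | steps n w = steps n w0] * gamma C.
Proof.
have [law indep] := hX.
(* Prescribed values for the first n steps, the event C for the next one. *)
pose A k : set lattice := if (k < n)%N then [set X k w0] else C.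
have fE : [set w | steps n w = steps n w0] =
    \bigcap_(k in [set` iota 0 n]) (X k @^-1` A k).
  rewrite steps_fiber; apply: eq_bigcapr => k /=; rewrite mem_iota => /andP[_ kn].
  by rewrite /A kn.
rewrite fE (indep _ A (iota_uniq 0 n)).
rewrite (_ : _ `&` _ = \bigcap_(k in [set` iota 0 n.+1]) (X k @^-1` A k)).
  rewrite (indep _ A (iota_uniq 0 n.+1)) -addn1 iotaD big_cat/= big_seq1 add0n.
  by congr (_ * _); rewrite /A ltnn; exact: law.
have memE k : [set` iota 0 n.+1] k = (k < n.+1)%N.
  by transitivity (is_true (k \in iota 0 n.+1)) => //; rewrite mem_iota.
apply/seteqP; split => [w [e Cw] k|w e].
  rewrite memE ltnS leq_eqVlt => /orP[/eqP ->|kn]; last first.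
    by apply: e; rewrite /= mem_iota.
  by rewrite /= /A ltnn.
split=> [k /=|]; last first.
  by have := e n; rewrite memE ltnSn /A /= ltnn; exact.
by rewrite mem_iota => /andP[_ kn]; apply: e; rewrite memE ltnW.
Qed.

(** On a fiber of the history, the restriction of [P] is pushed forward by [X n] to a
multiple of [gamma]. *)
Lemma steps_fiber_integral n w0 (G : lattice -> \bar R) : (forall y, 0 <= G y) ->
  \int[P]_(w in [set w | steps n w = steps n w0]) G (X n w) =
  \int[P]_(w in [set w | steps n w = steps n w0]) \int[gamma]_y G y.
Proof.
move=> G0; set E := [set w | _]; have mE : measurable E by exact: measurable_steps_fiber.
rewrite integral_cst//.
rewrite -ge0_integral_mrestr; last 2 first.
- exact: measurableT_comp.
- by move=> w.
rewrite -(@ge0_integral_pushforward _ _ _ _ _ (X n) _ (mrestr P mE) setT G)//.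
have PE : P E \is a fin_num by exact: fin_num_measure.
have PE0 : (0 <= fine (P E))%R by exact: fine_ge0.
rewrite (@eq_measure_integral _ _ _ _ (mscale (NngNum PE0) gamma)); last first.
  move=> A mA _; rewrite /= /pushforward /mrestr /mscale/= fineK//.
  by rewrite setIC steps_indep.
by rewrite ge0_integral_mscale//= fineK// muleC.
Qed.

(** The Markov property: conditionally on the first [n] steps, the next one may be
integrated out against [gamma]. *)
Lemma past_step_integral n (g : Omega -> lattice -> \bar R) :
  past n g -> (forall w y, 0 <= g w y) ->
  \int[P]_w g w (X n w) = \int[P]_w \int[gamma]_y g w y.
Proof.
move=> gn g0.
have m1 : measurable_fun [set: Omega] (fun w => g w (X n w)).
  apply: (@past_measurable _ _ n.+1) => w w' e; rewrite (e n)// (gn w w')// => k kn.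
  by apply: e; exact: ltnW.
have m2 : measurable_fun [set: Omega] (fun w => \int[gamma]_y g w y).
  by apply: (@past_measurable _ _ n) => w w' e; rewrite (gn w w').
rewrite (ge0_integral_countable_fibers _ (@measurable_steps_fiber n) m1)//.
rewrite (ge0_integral_countable_fibers _ (@measurable_steps_fiber n) m2)//; last first.
  by move=> w; exact: integral_ge0.
apply: eq_eseriesr => k _.
have [[w0 <-]|h] := pselect (exists w0, pickle (steps n w0) = k); last first.
  rewrite (_ : [set w | _] = set0) ?integral_set0//.
  by apply/seteqP; split => // w /= e; apply: h; exists w.
rewrite (_ : [set w | _] = [set w | steps n w = steps n w0]); last first.
  by apply/seteqP; split => w /=; [move/(pcan_inj pickleK)|move=> ->].
transitivity (\int[P]_(w in [set w | steps n w = steps n w0]) g w0 (X n w)).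
  by apply: eq_integral => w /[!inE] /= /steps_eqP/gn ->.
rewrite steps_fiber_integral//.
by apply: eq_integral => w /[!inE] /= /steps_eqP/gn ->.
Qed.

End markov.

(** * Survival and exit of the walk *)

Section killed_walk.
Local Open Scope ereal_scope.
Context {R : realType} {d : measure_display} {Omega : measurableType d}.
Context (P : probability Omega R) (X : nat -> {RV P >-> lattice}).
Variable gamma : probability lattice R.
Hypothesis hX : iid_steps X gamma.
Variable K : set (R * R).
Let D : set lattice := [set x | K (embed x)].

Lemma walk0 z w : walk X z 0 w = z.
Proof. by rewrite /walk big_ord0 addr0. Qed.

Lemma walkS z n w : walk X z n.+1 w = (walk X z n w + X n w)%R.
Proof. by rewrite /walk big_ord_recr addrA. Qed.

Lemma walk_past z n m : (m <= n)%N -> past X n (walk X z m).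
Proof.
move=> mn w w' e; rewrite /walk; congr (_ + _)%R; apply: eq_bigr => k _.
by apply: e; rewrite (leq_trans _ mn).
Qed.

Definition alive z n : set Omega :=
  [set w | forall k, (k <= n)%N -> D (walk X z k w)].

(** The index is the last time in [D]: the exit happens at time [n + 1]. *)
Definition exits_at z n : set Omega :=
  alive z n `&` [set w | ~ D (walk X z n.+1 w)].

Lemma alive_past {T} z n (a b : T) :
  past X n (fun w => if w \in alive z n then a else b).
Proof.
move=> w w' e; congr (if _ then _ else _); apply/idP/idP;
  move=> /set_mem aw; apply/mem_set => k kn; have := aw k kn;
  by rewrite (walk_past z kn e).
Qed.

Lemma measurable_alive z n : measurable (alive z n).
Proof.
have := past_measurable (@alive_past _ z n true false) measurableT.
move=> /(_ [set true] I); rewrite setTI; congr measurable.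
by apply/seteqP; split => [w /=|w aw /=]; [case: ifP => // /set_mem|rewrite mem_set].
Qed.

Lemma aliveS z n w : alive z n.+1 w <-> alive z n w /\ D (walk X z n.+1 w).
Proof.
split=> [a|[a Dw] k]; first by split=> [k kn|]; apply: a => //; exact: ltnW.
by rewrite leq_eqVlt => /orP[/eqP ->//|]; exact: a.
Qed.

Lemma measurable_exits_at z n : measurable (exits_at z n).
Proof.
rewrite (_ : exits_at z n = alive z n `\` alive z n.+1).
  by apply: measurableD; exact: measurable_alive.
apply/seteqP; split => [w [a nD]|w [a /aliveS/not_andP[//|nD]]]; split => //.
by move=> /aliveS[].
Qed.

(** Survival up to time [n] and the position at time [n] belong to the past of the
step [X n], which can therefore be averaged out. *)
Lemma alive_step_integral z n (F : lattice -> \bar R) : (forall y, 0 <= F y) ->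
  \int[P]_(w in alive z n) F (walk X z n.+1 w) =
  \int[P]_(w in alive z n) step_mean gamma F (walk X z n w).
Proof.
move=> F0; rewrite [LHS]integral_mkcond [RHS]integral_mkcond.
pose g w y := if w \in alive z n then F (walk X z n w + y)%R else 0.
transitivity (\int[P]_w g w (X n w)).
  by apply: eq_integral => w _; rewrite patchE /g walkS.
rewrite (past_step_integral hX); first last.
- by move=> w y; rewrite /g; case: ifP.
- move=> w w' e; apply/funext => y; rewrite /g (walk_past z (leqnn n) e).
  exact (@alive_past _ z n _ _ w w' e).
apply: eq_integral => w _; rewrite patchE /g; case: ifP => // _.
by rewrite integral0.
Qed.

(** Averaging out the last step peels off the innermost operator of the iterate, so
the induction on [n] changes the function rather than the starting point. *)
Lemma alive_integral z n (F : lattice -> \bar R) : D z -> (forall y, 0 <= F y) ->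
  \int[P]_(w in alive z n) F (walk X z n w) = iter n (killed_mean gamma D) F z.
Proof.
move=> Dz; elim: n F => [|n IH] F F0.
  rewrite (_ : alive z 0 = setT); last first.
    by apply/seteqP; split => // w _ k; rewrite leqn0 => /eqP ->; rewrite walk0.
  under eq_integral do rewrite walk0.
  by rewrite integral_cst//= (_ : P setT = 1) ?mule1//; exact: probability_setT.
rewrite iterSr -IH; last by move=> y; apply: killed_mean_ge0 => u _.
rewrite -alive_step_integral; last by move=> y; exact: erestrict_ge0.
rewrite integral_mkcond [RHS]integral_mkcond; apply: eq_integral => w _.
rewrite !patchE; case: ifPn => [/set_mem/aliveS[a Dw]|].
  by rewrite !mem_set.
rewrite notin_setE => /aliveS/not_andP na.
case: ifPn => // /set_mem a; rewrite memNset//.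
by case: na.
Qed.

Lemma exits_at_integral z n (F : lattice -> \bar R) : D z -> (forall y, 0 <= F y) ->
  \int[P]_(w in exits_at z n) F (walk X z n.+1 w) =
  iter n (killed_mean gamma D) (escape_mean gamma D F) z.
Proof.
move=> Dz F0; rewrite -alive_integral//; last by move=> y; exact: escape_mean_ge0.
rewrite -alive_step_integral; last by move=> y; exact: erestrict_ge0.
rewrite integral_mkcond [RHS]integral_mkcond; apply: eq_integral => w _.
rewrite !patchE; case: ifPn => [/set_mem[a Dw]|].
  by rewrite !mem_set.
rewrite notin_setE => /not_andP na.
case: ifPn => // /set_mem a; rewrite memNset// => nD.
by case: na.
Qed.

Lemma lt_tau z n w : (n%:R%:E < tau X K z w) <-> alive z n w.
Proof.
split=> [nt k kn|a].
  apply: contrapT => nK; move: nt; apply/negP; rewrite -leNgt.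
  apply: (@le_trans _ _ k%:R%:E); last by rewrite lee_fin ler_nat.
  by apply: ereal_inf_lbound; exists k.
apply: (@lt_le_trans _ _ n.+1%:R%:E); first by rewrite lte_fin ltr_nat.
apply: le_ereal_inf_tmp => _ [k /= nK <-]; rewrite lee_fin ler_nat ltnNge.
by apply/negP => kn; apply: nK; exact: a.
Qed.

Lemma tau_exits_at z n w : exits_at z n w -> tau X K z w = n.+1%:R%:E.
Proof.
move=> [a nD]; apply/eqP; rewrite eq_le; apply/andP; split.
  by apply: ereal_inf_lbound; exists n.+1.
apply: le_ereal_inf_tmp => _ [k /= nK <-]; rewrite lee_fin ler_nat ltnNge.
by apply/negP => kn; apply: nK; exact: a.
Qed.

Lemma walk_tau_exits_at z n w :
  exits_at z n w -> walk_tau X K z w = walk X z n.+1 w.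
Proof. by move=> e; rewrite /walk_tau (tau_exits_at e)/= natrK. Qed.

Lemma exits_bigcup z : D z -> exits X K z = \bigcup_n exits_at z n.
Proof.
move=> Dz; apply/seteqP; split => [w /= ty|w [n _ /tau_exits_at e]]; last first.
  by rewrite /exits /= e ltry.
have exK : exists n, `[< ~ D (walk X z n w) >].
  apply: contrapT => nex; move: ty; rewrite /exits /= (_ : tau _ _ _ _ = +oo) ?ltxx//.
  rewrite /tau (_ : [set _ | _ in _] = set0) ?ereal_inf0//.
  by rewrite -subset0 => _ [n /= nK _]; apply: nex; exists n; exact/asboolP.
have [n /asboolP nD nmin] := ex_minnP exK.
case: n nD nmin => [|n] nD nmin; first by move: nD; rewrite walk0.
exists n => //; split => // k kn; apply: contrapT => nDk.
by have := nmin k; rewrite ltnNge kn => /(_ (introT (asboolP _) nDk)).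
Qed.

Lemma measurable_walk_tau {d'} {T : measurableType d'} (F : lattice -> T) z :
  D z -> measurable_fun (exits X K z) (fun w => F (walk_tau X K z w)).
Proof.
move=> Dz; rewrite exits_bigcup//; apply/measurable_fun_bigcup.
  by move=> n; exact: measurable_exits_at.
move=> n; apply: (@eq_measurable_fun _ _ _ _ _ (fun w => F (walk X z n.+1 w))).
  by move=> w /set_mem /(@walk_tau_exits_at z n w) ->.
apply: measurable_funTS; apply: (@past_measurable _ _ _ P X _ _ n.+1) => w w' e.
by congr F; exact: walk_past (leqnn _) _ _ e.
Qed.

Lemma measurable_exits z : D z -> measurable (exits X K z).
Proof.
move=> Dz; rewrite exits_bigcup//; apply: bigcup_measurable => n _.
exact: measurable_exits_at.
Qed.

(** The identification of the mean at exit with its definition through the one-step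
kernel: the exit times split the event of exiting. *)
Lemma exits_integral z (F : lattice -> \bar R) : D z -> (forall y, 0 <= F y) ->
  \int[P]_(w in exits X K z) F (walk_tau X K z w) = exit_mean gamma D F z.
Proof.
move=> Dz F0; have mF := measurable_walk_tau F Dz.
rewrite exits_bigcup// in mF *; rewrite ge0_integral_bigcup//; last 2 first.
- by move=> n; exact: measurable_exits_at.
- apply/trivIsetP => i j _ _ /eqP ij; rewrite -subset0 => w [ei ej]; apply: ij.
  by have /eqP := tau_exits_at ei; rewrite (tau_exits_at ej) eqe eqr_nat => /eqP[].
apply: eq_eseriesr => n _; rewrite -exits_at_integral//.
by apply: eq_integral => w /set_mem /walk_tau_exits_at ->.
Qed.

End killed_walk.

(** * From supersolutions to positive harmonic functions *)

Section positive_harmonic.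
Context {R : realType} {d : measure_display} {Omega : measurableType d}.
Context (P : probability Omega R) (X : nat -> {RV P >-> lattice}).
Variables (gamma : probability lattice R) (K : set (R * R)) (w : lattice -> R).
Hypotheses (hX : iid_steps X gamma) (irr : killed_irreducible X K).
Let D : set lattice := [set x | K (embed x)].
Hypothesis w_gt0 : forall x, D x -> 0 < w x.
Hypothesis w_mean : forall x, D x -> step_mean gamma ((EFin \o w)^\+)%E x =
  ((w x)%:E + step_mean gamma ((EFin \o w)^\-)%E x)%E.
Hypothesis Wp_fin : forall x, D x ->
  (exit_mean gamma D ((EFin \o w)^\+)%E x < +oo)%E.
Hypothesis Wn_fin : forall x, D x ->
  (exit_mean gamma D ((EFin \o w)^\-)%E x < +oo)%E.
Hypothesis deep : forall z, D z -> exists2 z', D z' &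
  (exit_mean gamma D ((EFin \o w)^\+)%E z' < (w z')%:E)%E.

Let hw z := w z - \int[P]_(u in exits X K z) w (walk_tau X K z u).

Let wt z u : \bar R := (w (walk_tau X K z u))%:E.

Lemma exits_funepos z : D z -> (\int[P]_(u in exits X K z) ((wt z)^\+ u) =
  exit_mean gamma D (EFin \o w)^\+ z)%E.
Proof.
move=> Dz; rewrite -(exits_integral hX Dz); last by move=> y; exact: funepos_ge0.
by apply: eq_integral => u _; rewrite !funeposE.
Qed.

Lemma exits_funeneg z : D z -> (\int[P]_(u in exits X K z) ((wt z)^\- u) =
  exit_mean gamma D (EFin \o w)^\- z)%E.
Proof.
move=> Dz; rewrite -(exits_integral hX Dz); last by move=> y; exact: funeneg_ge0.
by apply: eq_integral => u _; rewrite !funenegE.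
Qed.

Lemma exits_integrable z : D z -> P.-integrable (exits X K z) (wt z).
Proof.
move=> Dz; apply/integrableP; split.
  exact: (@measurable_walk_tau _ _ _ P X K _ _ (EFin \o w) z Dz).
have mwt : measurable_fun (exits X K z) (wt z).
  exact: (@measurable_walk_tau _ _ _ P X K _ _ (EFin \o w) z Dz).
rewrite (eq_integral (fun u => (wt z)^\+ u + (wt z)^\- u)%E) => [|u _]; last first.
  rewrite funeposE funenegE /wt /=; case: (ger0P (w (walk_tau X K z u))) => w0.
    by rewrite max_l ?lee_fin// max_r ?adde0// lee_fin oppr_le0.
  by rewrite max_r ?lee_fin ?ltW// max_l ?add0e// lee_fin oppr_ge0 ltW.
rewrite ge0_integralD//.
- by rewrite exits_funepos// exits_funeneg// lte_add_pinfty ?Wp_fin ?Wn_fin.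
- exact: measurable_exits.
- exact: measurable_funepos.
- exact: measurable_funeneg.
Qed.

Lemma exit_defectE z : D z -> hw z = exit_defect gamma D w z.
Proof.
move=> Dz; rewrite /hw /exit_defect; congr (_ - _).
rewrite /Rintegral integralE exits_funepos// exits_funeneg// fineB//.
  by rewrite ge0_fin_numE ?Wp_fin// exit_mean_ge0// => y; exact: funepos_ge0.
by rewrite ge0_fin_numE ?Wn_fin// exit_mean_ge0// => y; exact: funeneg_ge0.
Qed.

(** Reachability for the killed walk, read on the iterates of its operator. *)
Lemma killed_positive z z' n : D z -> (0 < P [set u | walk X z n u = z' /\
    (n%:R%:E < tau X K z u)%E])%E ->
  (0 < iter n (killed_mean gamma D) (fun y => (y == z')%:R%:E) z)%E.
Proof.
move=> Dz; rewrite -(alive_integral hX _ Dz); last by move=> y; rewrite lee_fin.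
set A := [set u | _].
have AE : A = alive X K z n `&` (fun u => walk X z n u : int * int) @^-1` [set z'].
  apply/seteqP; split => u.
    by move=> [uz /lt_tau au].
  by move=> [au uz]; split => //; exact/lt_tau.
have mA : measurable A.
  rewrite AE; apply: measurableI; first exact: measurable_alive.
  by rewrite -[X in measurable X]setTI; apply: (@past_measurable _ _ _ P X _ lattice n) => //;
    exact: walk_past.
have AI : P A = (\int[P]_(u in alive X K z n) (\1_A u)%:E)%E.
  rewrite integral_indic//; last exact: measurable_alive.
  by congr (P _); apply/esym/setIidPl; rewrite AE; exact: subIsetl.
move=> A0; rewrite (_ : integral _ _ _ = P A)// AI.
apply: eq_integral => u /set_mem au; rewrite indicE; congr ((nat_of_bool _)%:R%:E).
apply/eqP/idP => [e|/set_mem[]//]; apply/mem_set; split => //; exact/lt_tau.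
Qed.

(** The analytic conditions under which correcting [w] by its mean at exit gives a
positive harmonic function; [deep] asks for a single good point for each [z], and
irreducibility carries the positivity back to [z]. *)
Lemma positive_harmonic :
  [/\ forall z, D z -> P.-integrable (exits X K z) (wt z),
      forall z, D z -> 0 < hw z & killed_harmonic X K hw].
Proof.
split=> [z Dz|z Dz|z Dz]; first exact: exits_integrable.
  rewrite exit_defectE//; have [z' Dz' lt] := deep Dz.
  have [n /(killed_positive Dz) it0] := irr Dz Dz'.
  exact: (exit_defect_gt0 w_gt0 w_mean Wp_fin Wn_fin Dz Dz' lt it0).
rewrite exit_defectE// -(exit_defect_harmonic w_gt0 w_mean Wp_fin Wn_fin Dz).
pose F := (EFin \o exit_defect gamma D w) \_ D.
have F0 y : (0 <= F y)%E.
  by apply: erestrict_ge0 => u Du; rewrite lee_fin exit_defect_ge0.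
have -> : killed_mean gamma D (EFin \o exit_defect gamma D w) z =
    iter 1 (killed_mean gamma D) F z.
  by apply: eq_killed_mean => y Dy; rewrite /F patchE mem_set.
rewrite -(alive_integral hX _ Dz)//.
have -> : [set u | (1 < tau X K z u)%E] = alive X K z 1.
  by apply/seteqP; split => u h; [exact: (lt_tau X K z 1 u).1 h|exact: (lt_tau X K z 1 u).2 h].
apply: eq_integral => u /set_mem a.
have Du := a 1%N (leqnn _); by rewrite /F patchE mem_set//= exit_defectE.
Qed.

End positive_harmonic.

(** * The plane and elementary exponential bounds *)

Section plane_lemmas.
Context {R : realType}.
Implicit Types (u v : R * R) (x y z : lattice) (s t : R).

Lemma embedD x y : embed (x + y) = embed x + embed y :> R * R.
Proof. by congr (_, _); rewrite /= intrD. Qed.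

Let fstD u v : (u + v).1 = u.1 + v.1. Proof. by []. Qed.
Let sndD u v : (u + v).2 = u.2 + v.2. Proof. by []. Qed.
Let fstZ s u : (s *: u).1 = s * u.1. Proof. by []. Qed.
Let sndZ s u : (s *: u).2 = s * u.2. Proof. by []. Qed.

Lemma dotDl u v w : dot (u + v) w = dot u w + dot v w :> R.
Proof. by rewrite /dot !fstD !sndD; ring. Qed.

Lemma dotDr u v w : dot u (v + w) = dot u v + dot u w :> R.
Proof. by rewrite /dot !fstD !sndD; ring. Qed.

Lemma dotZl s u v : dot (s *: u) v = s * dot u v.
Proof. by rewrite /dot fstZ sndZ; ring. Qed.

Lemma dotZr s u v : dot u (s *: v) = s * dot u v.
Proof. by rewrite /dot fstZ sndZ; ring. Qed.

Lemma dotC u v : dot u v = dot v u.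
Proof. by rewrite /dot /=; ring. Qed.

Lemma dot_embedD u x y : dot u (embed (x + y)) = dot u (embed x) + dot u (embed y).
Proof. by rewrite embedD dotDr. Qed.

(** Pairing with the [l1] norm of lattice points keeps exponential moments explicit:
[e^{c |z|_1}] is at most a sum of four exponentials of linear forms. *)
Definition l1norm u : R := `|u.1| + `|u.2|.

Lemma l1norm_ge0 u : 0 <= l1norm u.
Proof. by rewrite addr_ge0. Qed.

Lemma dot_le_l1norm u v : `|dot u v| <= l1norm u * l1norm v.
Proof.
rewrite (le_trans (ler_normD _ _))// !normrM /l1norm.
by have := normr_ge0 u.1; have := normr_ge0 u.2; have := normr_ge0 v.1;
  have := normr_ge0 v.2; nra.
Qed.

End plane_lemmas.

Section expR_bounds.
Context {R : realType}.
Implicit Type x : R.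

Lemma expR_sub1_le x : expR x - 1 <= x * expR x.
Proof.
have := expR_ge1Dx (- x); have := expRxMexpNx_1 x; have := expR_gt0 x.
by nra.
Qed.

Lemma norm_expR_sub1 x : `|expR x - 1| <= `|x| * expR `|x|.
Proof.
have h1 := expR_ge1Dx x; have h2 := expR_sub1_le x.
have [x0|x0] := leP 0 x.
  by rewrite !ger0_norm//; nra.
have h3 : expR x <= 1 by rewrite expR_le1 ltW.
have h4 : 1 <= expR (- x) by rewrite -expR0 ler_expR; lra.
by rewrite ler0_norm ?(ltr0_norm x0); nra.
Qed.

Lemma norm_expR_sub1x x : `|expR x - 1 - x| <= x ^+ 2 * expR `|x|.
Proof.
have h1 := expR_ge1Dx x; have h2 := expR_sub1_le x.
rewrite ger0_norm; last by nra.
have step : expR x - 1 - x <= x * (expR x - 1) by lra.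
apply: (le_trans step); rewrite (le_trans (ler_norm _))// normrM.
rewrite [leRHS](_ : _ = `|x| * (`|x| * expR `|x|)).
  by rewrite ler_wpM2l// norm_expR_sub1.
by rewrite mulrA -expr2 real_normK ?num_real.
Qed.

Lemma sqr_le_expR x : 0 <= x -> x ^+ 2 <= 2 * expR x.
Proof.
move=> x0; have := expR_ge1Dxn 1 x0; rewrite (_ : (2`!)%:R = 2 :> R)//.
by rewrite -ler_pdivrMl//; lra.
Qed.

Lemma expR_abs_le x : expR `|x| <= expR x + expR (- x).
Proof.
have := expR_gt0 x; have := expR_gt0 (- x); case: (ger0P x) => _; lra.
Qed.

End expR_bounds.

(** * Regularity of the Laplace transform of the step law *)

Section laplace.
Context {R : realType} (gamma : probability lattice R).
Hypothesis phi_fin : forall a : R * R, (phi_ext gamma a < +oo)%E.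
Implicit Types (a b u v : R * R) (x y z : lattice) (s t : R).

Lemma phi_extE a : phi_ext gamma a = (phi gamma a)%:E.
Proof.
rewrite fineK// ge0_fin_numE//; apply: integral_ge0 => z _.
by rewrite lee_fin expR_ge0.
Qed.

(** Exponentials are eigenfunctions of the free walk, with eigenvalue [phi]. *)
Lemma step_mean_exp a x :
  step_mean gamma (fun z => (expR (dot a (embed z)))%:E) x =
  (phi gamma a * expR (dot a (embed x)))%:E.
Proof.
rewrite mulrC EFinM -phi_extE -ge0_integralZl//.
by apply: eq_integral => y _; rewrite dot_embedD expRD EFinM.
Qed.

Lemma integrable_exp a :
  gamma.-integrable setT (fun z => (expR (dot a (embed z)))%:E).
Proof.
apply/integrableP; split=> //; apply: le_lt_trans (phi_fin a).
by apply: ge0_le_integral => // z _; rewrite /= ger0_norm ?expR_ge0.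
Qed.

Definition exp_bound a c z : R := expR (dot a (embed z) + c * l1norm (embed z : R * R)).

(** All exponential moments of linear forms are finite, hence those of the [l1] norm,
since [e^{|s| + |t|}] is at most [(e^s + e^-s) (e^t + e^-t)]. *)
Lemma integrable_exp_bound a c :
  0 <= c -> gamma.-integrable setT (EFin \o exp_bound a c).
Proof.
move=> c0.
pose E s t z := (expR (dot (a + (s, t)) (embed z)))%:E : \bar R.
have EI s t : gamma.-integrable setT (E s t) by exact: integrable_exp.
have := integrableD measurableT (integrableD measurableT (EI c c) (EI c (- c)))
  (integrableD measurableT (EI (- c) c) (EI (- c) (- c))).
apply: le_integrable => //= z _; rewrite /exp_bound lee_fin !ger0_norm; last 2 first.
- by rewrite !addr_ge0 ?expR_ge0.
- exact: expR_ge0.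
set p := (embed z).1 : R; set r := (embed z).2 : R.
have dotE s t : expR (dot (a + (s, t)) (embed z)) =
    expR (dot a (embed z)) * (expR (s * p) * expR (t * r)).
  by rewrite dotDl !expRD.
rewrite !dotE !mulNr expRD.
have -> : expR (c * l1norm (embed z : R * R)) = expR `|c * p| * expR `|c * r|.
  by rewrite !normrM (ger0_norm c0) -expRD -mulrDr.
rewrite [leRHS](_ : _ = expR (dot a (embed z)) *
  ((expR (c * p) + expR (- (c * p))) * (expR (c * r) + expR (- (c * r))))).
  by rewrite ler_pM2l ?expR_gt0// ler_pM ?expR_ge0// expR_abs_le.
by ring.
Qed.

Lemma bounded_integrable a c C (f : lattice -> R) : 0 <= c ->
  (forall z, `|f z| <= C * exp_bound a c z) -> gamma.-integrable setT (EFin \o f).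
Proof.
move=> c0 fle; have := integrableZl measurableT C (integrable_exp_bound a c0).
apply: le_integrable => // z _.
by rewrite /= lee_fin (le_trans (fle z))// ler_norm.
Qed.

Lemma bounded_integral a c C (f : lattice -> R) : 0 <= c ->
  (forall z, `|f z| <= C * exp_bound a c z) ->
  `|\int[gamma]_z f z| <= C * \int[gamma]_z exp_bound a c z.
Proof.
move=> c0 fle; have intf := bounded_integrable c0 fle.
rewrite (le_trans (le_normr_Rintegral _ intf))//.
rewrite -RintegralZl//; last exact: integrable_exp_bound.
apply: le_Rintegral => //; first exact: integrable_norm.
by have := integrableZl measurableT C (integrable_exp_bound a c0); apply: eq_integrable.
Qed.

(** The mean of the step law tilted by [e^{a.z}], up to its normalization. *)
Definition exp_mean a : R * R :=
  (\int[gamma]_z ((embed z).1 * expR (dot a (embed z))),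
   \int[gamma]_z ((embed z).2 * expR (dot a (embed z)))).

Lemma dot_exp_bound a v z :
  `|dot v (embed z) * expR (dot a (embed z))| <= 1 * exp_bound a (l1norm v) z.
Proof.
rewrite mul1r normrM (ger0_norm (expR_ge0 _)) mulrC /exp_bound expRD.
rewrite ler_wpM2l ?expR_ge0// (le_trans (dot_le_l1norm _ _))//.
by rewrite (le_trans _ (expR_ge1Dx _))// ler_wpDl.
Qed.

Lemma dot_integrable a v :
  gamma.-integrable setT (fun z => (dot v (embed z) * expR (dot a (embed z)))%:E).
Proof. exact: (bounded_integrable (l1norm_ge0 v) (dot_exp_bound a v)). Qed.

Lemma dot_exp_mean a v :
  \int[gamma]_z (dot v (embed z) * expR (dot a (embed z))) = dot (exp_mean a) v.
Proof.
rewrite [RHS]dotC /dot /=.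
have I1 : gamma.-integrable setT (fun z => ((embed z).1 * expR (dot a (embed z)))%:E).
  apply: eq_integrable (dot_integrable a (1, 0)) => // z _.
  by rewrite /dot /= mul1r mul0r addr0.
have I2 : gamma.-integrable setT (fun z => ((embed z).2 * expR (dot a (embed z)))%:E).
  apply: eq_integrable (dot_integrable a (0, 1)) => // z _.
  by rewrite /dot /= mul1r mul0r add0r.
rewrite -!RintegralZl// -RintegralD//.
- by apply: eq_Rintegral => z _; rewrite mulrDl !mulrA.
- exact: integrableZl I1.
- exact: integrableZl I2.
Qed.

(** A second-order estimate along lines, uniform in [t]; it yields both the directional
derivatives of [phi] and the existence of descent steps. *)
Lemma phi_taylor a v t : `|t| <= 1 ->
  `|phi gamma (a + t *: v) - phi gamma a - t * dot (exp_mean a) v| <=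
  t ^+ 2 * (2 * \int[gamma]_z exp_bound a (2 * l1norm v) z).
Proof.
move=> t1; rewrite -dot_exp_mean -RintegralZl//; last exact: dot_integrable.
rewrite /phi /phi_ext -/(Rintegral _ _ _) -/(Rintegral gamma setT _).
have Iexp b := integrable_exp b.
have Idot : gamma.-integrable setT
    (fun z => (t * (dot v (embed z) * expR (dot a (embed z))))%:E).
  exact: integrableZl (dot_integrable a v).
have Isub : gamma.-integrable setT
    (fun z => (expR (dot (a + t *: v) (embed z)) - expR (dot a (embed z)))%:E).
  exact: integrableB (Iexp _) (Iexp _).
rewrite -(RintegralB measurableT (Iexp _) (Iexp _)).
rewrite -(RintegralB measurableT Isub Idot) mulrA; apply: bounded_integral => [|z].
  by rewrite mulr_ge0// l1norm_ge0.
set u := dot v (embed z); rewrite dotDl dotZl -/u /exp_bound !(expRD (dot a (embed z))).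
rewrite [X in `|X|](_ : _ = expR (dot a (embed z)) * (expR (t * u) - 1 - t * u));
  last by ring.
rewrite normrM (ger0_norm (expR_ge0 _)) mulrCA ler_pM2l ?expR_gt0//.
apply: le_trans (norm_expR_sub1x _) _.
rewrite exprMn -[leLHS]mulrA -(mulrA (t ^+ 2)) ler_wpM2l ?sqr_ge0//.
have uz : `|u| <= l1norm v * l1norm (embed z : R * R) by exact: dot_le_l1norm.
have tu : `|t * u| <= `|u| by rewrite normrM ler_piMl.
rewrite -(real_normK (num_real u)).
apply: (@le_trans _ _ (2 * expR `|u| * expR `|u|)).
  by rewrite ler_pM ?sqr_ge0 ?expR_ge0 ?sqr_le_expR ?ler_expR.
rewrite -mulrA -expRD ler_pM2l// ler_expR.
by lra.
Qed.

Lemma phi_lipschitz a b : l1norm b <= 1 ->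
  `|phi gamma (a + b) - phi gamma a| <=
  l1norm b * \int[gamma]_z exp_bound a 2 z.
Proof.
move=> b1; rewrite /phi /phi_ext -/(Rintegral _ _ _) -/(Rintegral gamma setT _).
have Iexp c := integrable_exp c.
rewrite -(RintegralB measurableT (Iexp _) (Iexp _)); apply: bounded_integral => // z.
set u := dot b (embed z); rewrite dotDl -/u /exp_bound !(expRD (dot a (embed z))).
rewrite [X in `|X|](_ : _ = expR (dot a (embed z)) * (expR u - 1)); last by ring.
rewrite normrM (ger0_norm (expR_ge0 _)) mulrCA ler_pM2l ?expR_gt0//.
apply: le_trans (norm_expR_sub1 _) _.
have u1 : `|u| <= l1norm b * l1norm (embed z : R * R) by exact: dot_le_l1norm.
set N := l1norm (embed z : R * R) in u1 *.
have N0 : 0 <= N by exact: l1norm_ge0.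
have uN : `|u| <= N by rewrite (le_trans u1)// ler_piMl.
apply: (@le_trans _ _ (l1norm b * N * expR N)).
  by rewrite ler_pM ?expR_ge0// ler_expR.
rewrite -mulrA ler_wpM2l ?l1norm_ge0// (_ : 2 * N = N + N); last by ring.
rewrite expRD ler_pM2r ?expR_gt0//.
by rewrite (le_trans _ (expR_ge1Dx _))// ler_wpDl.
Qed.

End laplace.

Lemma near_l1norm {R : realType} (a : R * R) (e : R) : 0 < e ->
  \forall b \near a, l1norm (b - a) <= e.
Proof.
move=> e0; apply/nbhs_ballP; exists (e / 2); first by rewrite /= divr_gt0.
move=> b [/= b1 b2]; rewrite [e]splitr /l1norm.
by apply: lerD; rewrite distrC ltW.
Qed.

Section laplace_derivative.
Context {R : realType} (gamma : probability lattice R).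
Hypothesis phi_fin : forall a : R * R, (phi_ext gamma a < +oo)%E.
Implicit Types (a b u v : R * R) (t : R).

Lemma exp_bound_integral_ge0 a c : 0 <= \int[gamma]_z exp_bound (R := R) a c z.
Proof. by apply: Rintegral_ge0 => z _; exact: expR_ge0. Qed.

Lemma derive_phi a v : 'D_v (phi gamma) a = dot (exp_mean gamma a) v.
Proof.
set m := dot _ _; pose C := 2 * \int[gamma]_z exp_bound a (2 * l1norm v) z.
have C0 : 0 <= C by rewrite mulr_ge0// exp_bound_integral_ge0.
apply/cvg_lim => //; apply/cvgrPdist_le => e e0.
have eC : 0 < e / (C + 1) by rewrite divr_gt0// ltr_wpDl.
near=> h.
have h0 : h != 0 by near: h; exact: nbhs_dnbhs_neq.
have h1 : `|h| <= 1.
  by near: h; apply: dnbhs0_le.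
have h2 : `|h| <= e / (C + 1).
  by near: h; apply: dnbhs0_le.
rewrite /= -(ler_pM2l (x := `|h|)) ?normr_gt0// -normrM.
rewrite mulrBr distrC.
rewrite -[_ *: (_ - _)]/(_ * (_ - _)) mulVKf// [_ *: v + a]addrC.
rewrite (le_trans (phi_taylor phi_fin a v h1))// -/C -real_normK ?num_real//.
rewrite expr2 -mulrA ler_wpM2l//.
apply: (@le_trans _ _ (e / (C + 1) * C)); first by rewrite ler_wpM2r.
by rewrite mulrAC ler_pdivrMr ?ltr_wpDl// ler_wpM2l ?lerDl ?ler01// ltW.
Unshelve. all: by end_near. Qed.

Lemma gradient_phi a : gradient (phi gamma) a = exp_mean gamma a.
Proof.
rewrite [RHS]surjective_pairing /gradient !derive_phi.
by congr (_, _); rewrite /dot !(mulr1, mulr0, addr0, add0r).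
Qed.

Lemma phi_near a e : 0 < e ->
  \forall b \near a, `|phi gamma b - phi gamma a| <= e.
Proof.
move=> e0; pose C := \int[gamma]_z exp_bound a 2 z.
have C0 : 0 <= C by exact: exp_bound_integral_ge0.
have eC : 0 < Num.min 1 (e / (C + 1)).
  by rewrite lt_min ltr01 divr_gt0// ltr_wpDl.
near=> b; have : l1norm (b - a) <= Num.min 1 (e / (C + 1)).
  by near: b; exact: near_l1norm.
rewrite le_min => /andP[b1 b2].
have := phi_lipschitz phi_fin a b1; rewrite [a + _]addrC subrK => /le_trans; apply.
rewrite -/C (le_trans (ler_wpM2r C0 b2))// mulrAC ler_pdivrMr ?ltr_wpDl//.
by rewrite ler_wpM2l ?lerDl ?ler01// ltW.
Unshelve. all: by end_near. Qed.

(** By continuity of [phi], strict inequalities at [a] persist nearby. *)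
Lemma phi_boundary a :
  topological_boundary (phi_sublevel gamma) a -> phi gamma a = 1.
Proof.
move=> [cla nint]; apply/eqP; rewrite eq_le; apply/andP; split; rewrite leNgt;
  apply/negP => pa.
  have := @phi_near a ((phi gamma a - 1) / 2); rewrite divr_gt0 ?subr_gt0// => /(_ isT).
  move=> /cla [b [/= b1]]; rewrite ler_distlC => /andP[h1 h2].
  by rewrite /phi_sublevel /= in b1; lra.
apply: nint; rewrite /interior /=.
have := @phi_near a (1 - phi gamma a); rewrite subr_gt0 => /(_ pa).
apply: filterS => b /=; rewrite ler_distlC /phi_sublevel /= => /andP[h1 h2].
by lra.
Qed.

(** The negative linear term of the Taylor estimate dominates the quadratic error
for small [t]. *)
Lemma phi_descent a v : phi gamma a = 1 -> dot (exp_mean gamma a) v < 0 ->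
  exists2 t, 0 < t & phi gamma (a + t *: v) <= 1.
Proof.
set m := dot _ _ => pa m0; pose C := 2 * \int[gamma]_z exp_bound a (2 * l1norm v) z.
have C0 : 0 <= C by rewrite mulr_ge0// exp_bound_integral_ge0.
pose t := Num.min 1 (- m / (C + 1)).
have t0 : 0 < t by rewrite lt_min ltr01 divr_gt0 ?oppr_gt0// ltr_wpDl.
have t1 : t <= 1 by rewrite ge_min lexx.
have tC : t * (C + 1) <= - m by rewrite -ler_pdivlMr ?ltr_wpDl// ge_min lexx orbT.
exists t => //.
have /(phi_taylor phi_fin a v) : `|t| <= 1 by rewrite gtr0_norm.
rewrite -/m -/C ler_norml => /andP[_ h].
have : t * (t * C + m) <= 0 by rewrite pmulr_rle0//; nra.
by rewrite pa in h; nra.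
Qed.

End laplace_derivative.

(** * Geometry of the cone *)

Section cone_geometry.
Context {R : realType}.
Implicit Types u v z : R * R.
Variables c1 c2 f1 f2 : R * R.
Let K := open_cone c1 c2.
Hypotheses (hc1 : unit_circle c1) (hc2 : unit_circle c2).
Hypotheses (hf1 : inward_normal K c1 f1) (hf2 : inward_normal K c2 f2).

Lemma unit_circleP u : unit_circle u <-> dot u u = 1.
Proof.
rewrite /unit_circle /= /enorm; split => [e|->]; last by rewrite sqrtr1.
have d0 : 0 <= dot u u by rewrite /dot addr_ge0 // -expr2 sqr_ge0.
by rewrite -(sqr_sqrtr d0) e expr1n.
Qed.

Lemma open_cone_sub v : K v -> exists s t : R, [/\ 0 <= s, 0 <= t & v = s *: c1 + t *: c2].
Proof.
move=> /interior_subset [r [u [_ [s [t [s0 t0 ->]]]] [r0 ->]]].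
by exists (r * s), (r * t); split; rewrite ?mulr_ge0// scalerDr !scalerA.
Qed.

Lemma near_dot_gt0 u v : 0 < dot u v -> \forall w \near u, 0 < dot w v.
Proof.
move=> uv; have e0 : 0 < dot u v / (l1norm v + 1) by rewrite divr_gt0// ltr_wpDl ?l1norm_ge0.
have := near_l1norm u e0; apply: filterS => w uw.
have wu : `|dot (w - u) v| < dot u v.
  rewrite (le_lt_trans (dot_le_l1norm _ _))//.
  rewrite (le_lt_trans (ler_wpM2r (l1norm_ge0 v) uw))// mulrAC.
  by rewrite ltr_pdivrMr ?ltr_wpDl ?l1norm_ge0// ltr_pM2l// ltrDl.
have -> : dot w v = dot u v + dot (w - u) v by rewrite -dotDl addrC subrK.
by move: wu; rewrite ltr_norml => /andP[h _]; rewrite -(opprK (dot u v)) addrC subr_gt0.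
Qed.

Lemma dot_self_gt0 u v : 0 < dot u v -> 0 < dot u u.
Proof.
move=> uv; have : 0 <= dot u u by rewrite addr_ge0// -expr2 sqr_ge0.
rewrite le_eqVlt => /orP[/eqP u0|//].
have [u1 u2] : u.1 = 0 /\ u.2 = 0.
  have := sqr_ge0 u.1; have := sqr_ge0 u.2; rewrite !expr2 => h1 h2.
  by split; apply/eqP; rewrite -sqrf_eq0 expr2; apply/eqP; move: u0; rewrite /dot; lra.
by move: uv; rewrite /dot u1 u2 !mul0r addr0 ltxx.
Qed.

(** Points [c_i + e f_i] with small [e > 0] are nonnegative combinations of [c_1] and
[c_2]; pairing with [f_i] isolates the coefficient of the other edge, which must
then be positive. *)
Lemma normal_dot_gt0 : 0 < dot f1 c2 /\ 0 < dot f2 c1.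
Proof.
have [/unit_circleP f11 f1c1 K1] := hf1; have [/unit_circleP f22 f2c2 K2] := hf2.
split.
  near (0 : R)^'+ => e.
  have e0 : 0 < e by near: e; exact: nbhs_right_gt.
  have : K (c1 + e *: f1) by near: e.
  move=> /open_cone_sub[s [t [_ t0 /(congr1 (dot f1))]]].
  rewrite !dotDr !dotZr f11 f1c1 !mulr0 !add0r mulr1 => et.
  by rewrite ltNge; apply/negP => h; move: e0; rewrite et ltNge mulr_ge0_le0.
near (0 : R)^'+ => e.
have e0 : 0 < e by near: e; exact: nbhs_right_gt.
have : K (c2 + e *: f2) by near: e.
move=> /open_cone_sub[s [t [s0 _ /(congr1 (dot f2))]]].
rewrite !dotDr !dotZr f22 f2c2 !mulr0 !add0r addr0 mulr1 => es.
by rewrite ltNge; apply/negP => h; move: e0; rewrite es ltNge mulr_ge0_le0.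
Unshelve. all: by end_near. Qed.

(** The dual basis of [(c1, c2)] is, up to scaling, [(f2, f1)]. *)
Lemma cone_coordinates z :
  z = (dot z f2 / dot f2 c1) *: c1 + (dot z f1 / dot f1 c2) *: c2.
Proof.
have [/unit_circleP f11 f1c1 _] := hf1; have [/unit_circleP f22 f2c2 _] := hf2.
have [p1 p2] := normal_dot_gt0.
set s := _ / _; set t := _ / _.
pose w := z - (s *: c1 + t *: c2).
have w1 : dot w f1 = 0.
  rewrite dotC /w dotDr -scaleN1r dotZr dotDr !dotZr f1c1 /t [dot z f1]dotC.
  by rewrite mulr0 add0r divfK ?gt_eqF// mulN1r subrr.
have w2 : dot w f2 = 0.
  rewrite dotC /w dotDr -scaleN1r dotZr dotDr !dotZr f2c2 /s [dot z f2]dotC.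
  by rewrite mulr0 addr0 divfK ?gt_eqF// mulN1r subrr.
(* The determinant of (f1, f2): were it zero, f1 would be orthogonal to c1 and
   parallel to f2, hence zero because f2 is not orthogonal to c1. *)
pose D := f1.1 * f2.2 - f1.2 * f2.1.
have D0 : D != 0.
  apply/eqP => D0; have h1 : dot f2 c1 * f1.1 = 0.
    have -> : dot f2 c1 * f1.1 = f2.1 * dot f1 c1 + c1.2 * D by rewrite /dot /D; ring.
    by rewrite f1c1 D0 !mulr0 addr0.
  have h2 : dot f2 c1 * f1.2 = 0.
    have -> : dot f2 c1 * f1.2 = f2.2 * dot f1 c1 - c1.1 * D by rewrite /dot /D; ring.
    by rewrite f1c1 D0 !mulr0 subr0.
  move: h1 h2 => /eqP; rewrite mulf_eq0 gt_eqF//= => /eqP h1 /eqP.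
  rewrite mulf_eq0 gt_eqF//= => /eqP h2.
  by move: f11; rewrite /dot h1 h2 !mul0r addr0 => /esym/eqP; rewrite oner_eq0.
have w01 : w.1 = 0.
  apply: (mulfI D0); rewrite mulr0 -[RHS](_ : f2.2 * dot w f1 - f1.2 * dot w f2 = 0).
    by rewrite /dot /D; ring.
  by rewrite w1 w2 !mulr0 subr0.
have w02 : w.2 = 0.
  apply: (mulfI D0); rewrite mulr0 -[RHS](_ : f1.1 * dot w f2 - f2.1 * dot w f1 = 0).
    by rewrite /dot /D; ring.
  by rewrite w1 w2 !mulr0 subr0.
apply/eqP; rewrite -subr_eq0 -/w; apply/eqP.
by rewrite [LHS]surjective_pairing w01 w02.
Qed.

Lemma open_coneP z : K z <-> 0 < dot z f1 /\ 0 < dot z f2.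
Proof.
have [/unit_circleP f11 f1c1 _] := hf1; have [/unit_circleP f22 f2c2 _] := hf2.
have [p1 p2] := normal_dot_gt0.
split=> [Kz|[z1 z2]].
  have inner_gt0 f : dot f f = 1 -> (forall v, (exists s t : R,
      [/\ 0 <= s, 0 <= t & v = s *: c1 + t *: c2]) -> 0 <= dot v f) -> 0 < dot z f.
    move=> ff Cf; have /nbhs_ballP[e /= e0 eK] := Kz.
    have fle : `|f.1| <= 1 /\ `|f.2| <= 1.
      have := sqr_ge0 f.1; have := sqr_ge0 f.2; move: ff; rewrite /dot -!expr2 => ff h1 h2.
      split; rewrite -[leRHS](@normr1 R) -ler_sqr ?nnegrE// !real_normK ?num_real// expr1n;
      lra.
    (* A neighbour of z pushed towards the edge with normal f is still in the cone. *)
    have zB : ball z e (z - (e / 2) *: f).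
      have e2 : 0 < e / 2 by rewrite divr_gt0.
      case: fle => g1 g2.
      split; rewrite /ball/= opprD opprK addNKr normrM gtr0_norm//;
        rewrite (@le_lt_trans _ _ (e / 2))//; try (rewrite ler_piMr// ltW//); lra.
    have [r [u [[_ [s [t [s0 t0 ue]]]] [r0 ve]]]] := eK _ zB.
    have := Cf (z - (e / 2) *: f); rewrite -scaleNr dotDl dotZl ff mulr1 => h.
    have : 0 <= dot z f + - (e / 2).
      apply: h; exists (r * s), (r * t); split; rewrite ?mulr_ge0//.
      by rewrite scaleNr ve ue scalerDr !scalerA.
    by lra.
  split; apply: inner_gt0 => // v [s [t [s0 t0 ->]]].
    by rewrite dotC dotDr !dotZr f1c1 mulr0 add0r mulr_ge0// ltW.
  by rewrite dotC dotDr !dotZr f2c2 mulr0 addr0 mulr_ge0// ltW.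
rewrite /K /open_cone /interior /=.
have := near_dot_gt0 z1; have := near_dot_gt0 z2; apply: filterS2 => w w2 w1.
have ww := dot_self_gt0 w1; have r0 : 0 < enorm w by rewrite sqrtr_gt0.
exists (enorm w), ((enorm w)^-1 *: w); last first.
  by split; [exact: ltW|rewrite scalerA divff ?gt_eqF// scale1r].
split.
  apply/unit_circleP; rewrite dotZl dotZr mulrA -expr2 exprVn.
  by rewrite sqr_sqrtr ?ltW// mulVf// gt_eqF.
exists ((enorm w)^-1 * (dot w f2 / dot f2 c1)), ((enorm w)^-1 * (dot w f1 / dot f1 c2)).
split; [by rewrite mulr_ge0 ?invr_ge0 ?divr_ge0// ltW..|].
by rewrite -!(scalerA (enorm w)^-1) -scalerDr -cone_coordinates.
Qed.

Lemma closure_open_cone z : closure K z -> 0 <= dot z f1 /\ 0 <= dot z f2.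
Proof.
move=> clz; have cl f : (forall w, K w -> 0 < dot w f) -> 0 <= dot z f.
  move=> Kf; rewrite leNgt; apply/negP => zf.
  have : 0 < dot z (- f) by rewrite -scaleN1r dotZr mulN1r oppr_gt0.
  move=> /near_dot_gt0/clz[w [/Kf wf]].
  by rewrite -scaleN1r dotZr mulN1r oppr_gt0 ltNge ltW.
by split; apply: cl => w /open_coneP[].
Qed.

(** A unit vector of the closed cone off the open cone annihilates one of the
normals, so by [cone_coordinates] it is a nonnegative multiple of an edge. *)
Lemma Sigma_cases u : Sigma K u -> [\/ u = c1, u = c2 | int_Sigma K u].
Proof.
move=> [/closure_open_cone[u1 u2] /[dup] uc /unit_circleP uu].
have [/unit_circleP f11 f1c1 _] := hf1; have [/unit_circleP f22 f2c2 _] := hf2.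
have [p1 p2] := normal_dot_gt0.
have unit_ray c s : dot c c = 1 -> 0 <= s -> u = s *: c -> u = c.
  move=> cc s0 us; move: uu; rewrite us dotZl dotZr cc mulr1 -expr2 => /eqP.
  by rewrite sqrf_eq1 => /orP[/eqP ->|/eqP s1]; [rewrite scale1r|move: s0; rewrite s1 ler0N1].
have := cone_coordinates u.
have [u1p|] := ltP 0 (dot u f1); last first.
  move=> u1n; have -> : dot u f1 = 0 by apply/le_anti; rewrite u1 u1n.
  rewrite mul0r scale0r addr0 => /unit_ray e; apply: Or31; apply: e.
    exact/unit_circleP.
  by rewrite divr_ge0// ltW.
have [u2p|] := ltP 0 (dot u f2); last first.
  move=> u2n; have -> : dot u f2 = 0 by apply/le_anti; rewrite u2 u2n.
  rewrite mul0r scale0r add0r => /unit_ray e; apply: Or32; apply: e.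
    exact/unit_circleP.
  by rewrite divr_ge0// ltW.
by move=> _; apply: Or33; split => //; apply/open_coneP.
Qed.

End cone_geometry.

(** * Steps that cross a line *)

Section support.
Context {R : realType} {d : measure_display} {Omega : measurableType d}.
Context (P : probability Omega R) (X : nat -> {RV P >-> lattice}).
Variable gamma : probability lattice R.
Hypothesis hX : iid_steps X gamma.

(** The lattice is countable. *)
Lemma null_points (N : set lattice) :
  (forall y, N y -> gamma [set y] = 0%E) -> gamma N = 0%E.
Proof.
move=> N0; apply/eqP; rewrite eq_le measure_ge0 andbT.
pose F k : set lattice := [set y | N y /\ pickle (y : int * int) = k].
have F0 k : gamma (F k) = 0%E.
  have [[y [Ny yk]]|h] := pselect (exists y, F k y).
    rewrite (_ : F k = [set y]) ?N0//; apply/seteqP; split => [u [_]|u ->//].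
    by rewrite -yk => /(pcan_inj pickleK).
  rewrite (_ : F k = set0) ?measure0// -subset0 => y Fy; apply: h; by exists y.
rewrite -(@eseries0 _ (fun k => gamma (F k)) 0 xpredT) => [|k _ _]; last exact: F0.
apply: measure_sigma_subadditive => // y Ny.
by exists (pickle (y : int * int)).
Qed.

(** Otherwise almost every step would be in the half-plane where [f] is nonnegative
and the walk could never reach a point on the other side. *)
Lemma exists_negative_step (f : R * R) : irreducible_walk X -> dot f f = 1 ->
  exists2 y, (0 < gamma [set y])%E & dot f (embed y) < 0.
Proof.
move=> irr ff; have [x xf] : exists x : lattice, dot f (embed x) < 0.
  have [f1|f1|f1] := ltrgt0P f.1.
  - by exists (- 1, 0); rewrite /dot /=; lra.
  - by exists (1, 0); rewrite /dot /=; lra.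
  have [f2|f2|f2] := ltrgt0P f.2.
  - by exists (0, - 1); rewrite /dot /=; lra.
  - by exists (0, 1); rewrite /dot /=; lra.
  by move: ff; rewrite /dot f1 f2 mulr0 addr0 => /eqP; rewrite eq_sym oner_eq0.
pose N : set lattice := [set y | dot f (embed y) < 0].
apply: contrapT => h.
have N0 : gamma N = 0%E.
  apply: null_points => y Ny; apply/eqP; rewrite eq_le measure_ge0 andbT leNgt.
  by apply/negP => y0; apply: h; exists y.
have [n] := irr 0 x; apply/negP; rewrite -leNgt.
have P0 k : P (X k @^-1` N) = 0%E by rewrite -N0 -(hX.1 k).
rewrite -(@eseries0 _ (fun k => P (X k @^-1` N)) 0 xpredT) => [|k _ _]; last exact: P0.
apply: measure_sigma_subadditive.
- by move=> k; exact: measurable_funPTI.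
- apply: (measurable_countable_fibers (Y := fun w => (walk X 0 n w : int * int)) _
    [set x : int * int]) => t.
  have -> : [set w | (walk X 0 n w : int * int) = t] = walk X 0 n @^-1` [set t] by [].
  by rewrite -[X in measurable X]setTI; apply: (@past_measurable _ _ _ P X _ _ n) => //;
    exact: walk_past.
move=> w /= wx; apply: contrapT => nN.
suff : 0 <= dot f (embed (walk X 0 n w)) by rewrite wx leNgt xf.
elim: n {wx} => [|n IH]; first by rewrite walk0 /dot /= !mulr0 addr0.
rewrite walkS dot_embedD addr_ge0// leNgt; apply/negP => neg; apply: nN; by exists n.
Qed.

End support.

(** * Supersolutions for the two kinds of directions *)

Section supersolutions.
Context {R : realType} (gamma : probability lattice R).
Hypothesis phi_fin : forall a : R * R, (phi_ext gamma a < +oo)%E.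
Variables f g : R * R.
Let D : set lattice := [set x | 0 < dot f (embed x) /\ 0 < dot g (embed x)].
Implicit Types (a b : R * R) (x y z : lattice) (c t : R).

(** Off [D] the function [F] may be replaced by its majorant [V], after which the
supersolution inequality of [exit_mean_le] reads [step_mean gamma V <= V]. *)
Lemma superharmonic_exit_bound (F V : lattice -> \bar R) :
  (forall x, 0 <= F x)%E -> (forall x, 0 <= V x)%E ->
  (forall x, ~ D x -> F x <= V x)%E ->
  (forall x, D x -> step_mean gamma V x <= V x)%E ->
  forall x, D x -> (exit_mean gamma D F x <= V x)%E.
Proof.
move=> F0 V0 FV Vs; apply: exit_mean_le => // x Dx.
apply: le_trans (Vs x Dx); rewrite (step_mean_split _ D _ V0) addeC leeD2l//.
by apply: step_mean_le => y; [exact: erestrict_ge0|exact: lee_restrict].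
Qed.

(** The integral of [w (x + y)] is the difference of those of the two parts of [w];
with the negative one moved across, only nonnegative terms remain. *)
Lemma step_mean_harmonic (w : lattice -> R) x :
  gamma.-integrable setT (fun y => (w (x + y))%:E) ->
  \int[gamma]_y w (x + y) = w x ->
  step_mean gamma ((EFin \o w)^\+)%E x =
    ((w x)%:E + step_mean gamma ((EFin \o w)^\-)%E x)%E.
Proof.
move=> wi wx.
have n := integrable_fin_num measurableT (integrable_funeneg measurableT wi).
have : (\int[gamma]_y (w (x + y))%:E)%E = (w x)%:E.
  by rewrite -wx fineK//; exact: integrable_fin_num.
have -> : step_mean gamma ((EFin \o w)^\-)%E x =
    (\int[gamma]_y ((fun y => (w (x + y))%:E)^\- y))%E.
  by apply: eq_integral => y _; rewrite !funenegE.
have -> : step_mean gamma ((EFin \o w)^\+)%E x =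
    (\int[gamma]_y ((fun y => (w (x + y))%:E)^\+ y))%E.
  by apply: eq_integral => y _; rewrite !funeposE.
by rewrite integralE => <-; rewrite subeK.
Qed.

Lemma embedMn z k : embed (z *+ k) = k%:R *: embed z :> R * R.
Proof.
elim: k => [|k IH]; first by rewrite mulr0n scale0r.
by rewrite mulrSr embedD IH -natr1 scalerDl scale1r.
Qed.

Lemma D_mulrn z k : D z -> D (z *+ k.+1).
Proof. by move=> [z1 z2]; split; rewrite embedMn dotZr mulr_gt0. Qed.

Section interior.
Variable a : R * R.
Hypothesis phi1 : phi gamma a = 1.
Let w x : R := expR (dot a (embed x)).

Lemma interior_harmonic x : step_mean gamma ((EFin \o w)^\+)%E x =
    ((w x)%:E + step_mean gamma ((EFin \o w)^\-)%E x)%E.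
Proof.
have wE y : (w (x + y))%:E = ((w x)%:E * (expR (dot a (embed y)))%:E)%E.
  by rewrite /w dot_embedD expRD.
apply: step_mean_harmonic.
  apply: eq_integrable (integrableZl measurableT (w x) (integrable_exp phi_fin a)) => //.
transitivity (fine (step_mean gamma (fun z => (w z)%:E) x)) => //.
by rewrite step_mean_exp//= phi1 mul1r.
Qed.

Hypotheses (mf : 0 < dot (exp_mean gamma a) f) (mg : 0 < dot (exp_mean gamma a) g).

(** A point off [D] has [f.x <= 0] or [g.x <= 0], and one of the two exponentials
on the right then exceeds [w]. *)
Lemma interior_bounds : exists t s, [/\ 0 < t, 0 < s &
  forall x, D x -> (exit_mean gamma D ((EFin \o w)^\+)%E x <=
    (w x * (expR (- t * dot f (embed x)) + expR (- s * dot g (embed x))))%:E)%E].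
Proof.
have [t t0 pt] : exists2 t, 0 < t & phi gamma (a + t *: (- f)) <= 1.
  by apply: phi_descent => //; rewrite -scaleN1r dotZr mulN1r oppr_lt0.
have [s s0 ps] : exists2 s, 0 < s & phi gamma (a + s *: (- g)) <= 1.
  by apply: phi_descent => //; rewrite -scaleN1r dotZr mulN1r oppr_lt0.
exists t, s; split => //.
pose V x := ((expR (dot (a + t *: (- f)) (embed x)))%:E
           + (expR (dot (a + s *: (- g)) (embed x)))%:E)%E.
have VE x : V x =
    (w x * (expR (- t * dot f (embed x)) + expR (- s * dot g (embed x))))%:E.
  have expE r (h : R * R) : expR (dot (a + r *: (- h)) (embed x)) =
      w x * expR (- r * dot h (embed x)).
    by rewrite dotDl dotZl -scaleN1r dotZl mulN1r mulrN -mulNr expRD.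
  by rewrite mulrDr EFinD -!expE.
move=> x Dx; rewrite -VE; move: x Dx; apply: superharmonic_exit_bound.
- by move=> x; exact: funepos_ge0.
- by move=> x; rewrite adde_ge0 ?lee_fin ?expR_ge0.
- move=> x nD; rewrite funeposE /= max_l; last by rewrite lee_fin expR_ge0.
  rewrite -[leRHS]/(V x) VE lee_fin.
  rewrite ler_peMr ?expR_ge0//.
  have [f1|f1] := leP (dot f (embed x)) 0.
    rewrite -[leLHS]addr0 lerD ?expR_ge0// -[leLHS]expR0 ler_expR mulNr oppr_ge0.
    by rewrite pmulr_rle0.
  have [g1|g1] := leP (dot g (embed x)) 0.
    rewrite -[leLHS]add0r lerD ?expR_ge0// -[leLHS]expR0 ler_expR mulNr oppr_ge0.
    by rewrite pmulr_rle0.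
  by case: nD.
move=> x Dx; rewrite step_meanD; [|by move=> y; rewrite lee_fin expR_ge0..].
by rewrite !step_mean_exp// leeD// lee_fin ler_piMl ?expR_ge0.
Qed.

Lemma interior_nonneg x : exit_mean gamma D ((EFin \o w)^\-)%E x = 0%E.
Proof.
have -> : ((EFin \o w)^\-)%E = (fun=> 0%E).
  by apply/funext => y; rewrite funenegE /= max_r// lee_fin oppr_le0 expR_ge0.
rewrite /exit_mean eseries0// => n _ _.
have e0 : escape_mean gamma D (fun=> 0%E) = (fun=> 0%E).
  apply/funext => y; rewrite -[RHS](integral0 gamma setT); apply: eq_integral => u _.
  by rewrite patchE; case: ifP.
rewrite e0; elim: n x => //= n IH x.
rewrite -[RHS](integral0 gamma setT); apply: eq_integral => u _.
by rewrite patchE; case: ifP => // _; exact: IH.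
Qed.

(** Along [k z] both coordinates [f.x] and [g.x] grow, so the bound of
[interior_bounds] becomes less than [w]. *)
Lemma interior_deep z : D z -> exists2 z', D z' &
  (exit_mean gamma D ((EFin \o w)^\+)%E z' < (w z')%:E)%E.
Proof.
move=> Dz; have [t [s [t0 s0 b]]] := interior_bounds; have [zf zg] := Dz.
set k := (Num.truncn ((t * dot f (embed z))^-1 + (s * dot g (embed z))^-1)).
exists (z *+ k.+1); first exact: D_mulrn.
apply: (le_lt_trans (b _ (D_mulrn k Dz))); rewrite lte_fin gtr_pMr ?expR_gt0//.
have kgt : (t * dot f (embed z))^-1 + (s * dot g (embed z))^-1 < k.+1%:R.
  exact: truncnS_gt.
(* expR t > 1 + t >= 2 as soon as t = k.+1 * r exceeds 1. *)
have half (r : R) : 0 < r -> r^-1 < k.+1%:R -> expR (- (k.+1%:R * r)) < 2^-1.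
  move=> r0 rk; rewrite expRN ltf_pV2 ?posrE ?expR_gt0//.
  rewrite (lt_le_trans _ (expR_ge1Dx _))//.
  have : 1 < k.+1%:R * r by rewrite -ltr_pdivrMr// div1r.
  lra.
have p1 : 0 < t * dot f (embed z) by rewrite mulr_gt0.
have p2 : 0 < s * dot g (embed z) by rewrite mulr_gt0.
have i1 : 0 < (t * dot f (embed z))^-1 by rewrite invr_gt0.
have i2 : 0 < (s * dot g (embed z))^-1 by rewrite invr_gt0.
have := half _ p1; have := half _ p2.
rewrite embedMn !dotZr !mulNr ![_ * (k.+1%:R * _)]mulrCA => h2 h1.
have := h1 ltac:(lra); have := h2 ltac:(lra); lra.
Qed.

End interior.

End supersolutions.

Section boundary.
Context {R : realType} (gamma : probability lattice R).
Hypothesis phi_fin : forall a : R * R, (phi_ext gamma a < +oo)%E.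
Variables f g : R * R.
Let D : set lattice := [set x | 0 < dot f (embed x) /\ 0 < dot g (embed x)].
Variable a : R * R.
Hypothesis phi1 : phi gamma a = 1.
Hypothesis mf : dot (exp_mean gamma a) f = 0.
Implicit Types (b : R * R) (x y z : lattice) (c t : R).
Let w x : R := dot f (embed x) * expR (dot a (embed x)).

(** Tilted by [e^{a.z}], the walk [f.S(n)] is centred. *)
Lemma boundary_harmonic x : step_mean gamma ((EFin \o w)^\+)%E x =
    ((w x)%:E + step_mean gamma ((EFin \o w)^\-)%E x)%E.
Proof.
pose e y := expR (dot a (embed y)).
have wE y : w (x + y) = w x * e y + e x * (dot f (embed y) * e y).
  by rewrite /w /e !dot_embedD expRD; ring.
have I1 : gamma.-integrable setT (fun y => (w x * e y)%:E).
  exact: integrableZl (integrable_exp phi_fin a).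
have I2 : gamma.-integrable setT (fun y => (e x * (dot f (embed y) * e y))%:E).
  exact: integrableZl (dot_integrable phi_fin a f).
apply: step_mean_harmonic.
  apply: eq_integrable (integrableD measurableT I1 I2) => // y _.
  by rewrite wE.
under eq_Rintegral do rewrite wE.
rewrite RintegralD// !RintegralZl//; last 2 first.
- exact: dot_integrable.
- exact: integrable_exp.
by rewrite dot_exp_mean// mf mulr0 addr0 (_ : Rintegral _ _ _ = phi gamma a)// phi1 mulr1.
Qed.

(** Off [D], [w] is positive only where [g.x <= 0 < f.x], and there [s <= e^s / e]
bounds [f.x] by an exponential whose exponent also decreases in [g.x].  The
direction [v] is chosen orthogonal to [z], so that the bound along the ray
[k z] is a constant times [e^{a.x}], whereas [w] grows faster by a factor [k]. *)
Lemma boundary_positive_part (mg : 0 < dot (exp_mean gamma a) g) z : D z ->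
  exists2 C, 0 < C & exists2 v, dot v (embed z) = 0 & forall x, D x ->
  (exit_mean gamma D ((EFin \o w)^\+)%E x <= (C * expR (dot (a + v) (embed x)))%:E)%E.
Proof.
move=> [zf zg]; pose v0 := dot g (embed z) *: f - dot f (embed z) *: g.
have [t t0 pt] : exists2 t, 0 < t & phi gamma (a + t *: v0) <= 1.
  apply: phi_descent => //; rewrite /v0 dotDr -scaleNr !dotZr mf mulr0 add0r.
  by rewrite mulNr oppr_lt0 mulr_gt0.
pose e := t * dot g (embed z); have e0 : 0 < e by rewrite mulr_gt0.
exists e^-1; first by rewrite invr_gt0.
exists (t *: v0).
  by rewrite /v0 dotZl dotDl -scaleNr !dotZl; ring.
apply: superharmonic_exit_bound.
- by move=> x; exact: funepos_ge0.
- by move=> x; rewrite lee_fin mulr_ge0 ?expR_ge0// invr_ge0 ltW.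
- move=> x nD; rewrite funeposE /= /w.
  have V0 : 0 <= e^-1 * expR (dot (a + t *: v0) (embed x)).
    by rewrite mulr_ge0 ?expR_ge0// invr_ge0 ltW.
  have [fx|fx] := leP (dot f (embed x)) 0.
    by rewrite max_r ?lee_fin// mulr_le0_ge0 ?expR_ge0.
  have gx : dot g (embed x) <= 0 by rewrite leNgt; apply/negP => gx; exact: nD.
  rewrite max_l ?lee_fin; last by rewrite mulr_ge0 ?expR_ge0// ltW.
  rewrite dotDl expRD mulrCA [leLHS]mulrC ler_pM2l ?expR_gt0//.
  rewrite -ler_pdivrMl ?invr_gt0// invrK.
  have -> : dot (t *: v0) (embed x) =
      e * dot f (embed x) - t * dot f (embed z) * dot g (embed x).
    by rewrite /v0 dotZl dotDl -scaleNr !dotZl /e; ring.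
  apply: (@le_trans _ _ (expR (e * dot f (embed x)))).
    by rewrite (le_trans _ (expR_ge1Dx _))// lerDr.
  rewrite ler_expR lerDl oppr_ge0 mulr_ge0_le0// mulr_ge0// ltW//.
move=> x Dx; set V := fun _ => _.
have -> : V = fun y => (e^-1%:E * (expR (dot (a + t *: v0) (embed y)))%:E)%E by [].
rewrite /step_mean ge0_integralZl//; last by rewrite lee_fin invr_ge0 ltW.
rewrite -/(step_mean gamma (fun y => (expR (dot (a + t *: v0) (embed y)))%:E) x).
rewrite step_mean_exp// -EFinM lee_fin ler_pM2l ?invr_gt0//.
by rewrite ler_piMl ?expR_ge0.
Qed.

Lemma boundary_deep (mg : 0 < dot (exp_mean gamma a) g) z : D z ->
  exists2 z', D z' & (exit_mean gamma D ((EFin \o w)^\+)%E z' < (w z')%:E)%E.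
Proof.
move=> Dz; have [C C0 [v vz b]] := boundary_positive_part mg Dz.
have [zf zg] := Dz.
pose k := Num.truncn (C / dot f (embed z)).
have kC : C < k.+1%:R * dot f (embed z) by rewrite -ltr_pdivrMr// truncnS_gt.
exists (z *+ k.+1); first exact: D_mulrn.
apply: (le_lt_trans (b _ (D_mulrn k Dz))); rewrite lte_fin /w embedMn dotDl !dotZr.
by rewrite vz mulr0 addr0 ltr_pM2r// expR_gt0.
Qed.

Variable y0 : lattice.
Hypotheses (y0_pos : (0 < gamma [set y0])%E) (y0_neg : dot f (embed y0) < 0).

Lemma integral_point_mass c : 0 <= c ->
  (\int[gamma]_y (c%:E * (\1_[set y0] y)%:E) = c%:E * gamma [set y0])%E.
Proof.
by move=> c0; rewrite ge0_integralZl_EFin// integral_indic// setIT.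
Qed.

(** The supersolution is [e^{a.x} u(f.x)] with [u s = C (A - e^{- r s})] for
[s > 0] and [u s = - s] for [s <= 0].  The drift of [- e^{- r s}] under the
centred tilted walk must outweigh the expected overshoot, which is at most
[(psi / r) e^{- r s} = C e^{- r s}].  The step [y0], of tilted mass [p] and
height [- c], provides this: for [s > c] it alone contributes [p e^{r c} >= 2]
times [C e^{- r s}] once [r] is large, and for [s <= c] it makes the walk lose
the constant [C A], where [A = 2 / p].  Such an [r] is available because all
exponential moments are finite. *)
Lemma boundary_negative_part : forall x, D x ->
  (exit_mean gamma D ((EFin \o w)^\-)%E x < +oo)%E.
Proof.
pose E b x : R := expR (dot b (embed x)).
pose c := - dot f (embed y0); have c0 : 0 < c by rewrite oppr_gt0.
pose p := fine (gamma [set y0]) * E a y0.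
have gfin : gamma [set y0] \is a fin_num by exact: fin_num_measure.
have g0 : 0 < fine (gamma [set y0]).
  by rewrite fine_gt0// y0_pos ltey_eq gfin.
have pE : p = fine (gamma [set y0]) * E a y0 by [].
have p0 : 0 < p by rewrite mulr_gt0// expR_gt0.
clearbody p.
(* Then r * c = A = 2 / p, so that p * expR (r * c) >= p * (r * c) = 2. *)
pose r := 2 / (p * c); have r0 : 0 < r by rewrite divr_gt0// mulr_gt0.
pose psi := phi gamma (a - r *: f).
have psi0 : 0 <= psi.
  by rewrite fine_ge0// integral_ge0// => y _; rewrite lee_fin expR_ge0.
pose C := psi / r; have C0 : 0 <= C by rewrite divr_ge0// ltW.
have CE : C = psi / r by [].
pose A := 2 / p; have Ap : A * p = 2 by rewrite divfK// gt_eqF.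
clearbody C.
have p1 : p <= 1.
  rewrite -lee_fin -phi1 -phi_extE// pE mulrC EFinM fineK// -integral_point_mass ?expR_ge0//.
  apply: ge0_le_integral => //.
  - by move=> y _; rewrite mule_ge0// lee_fin ?expR_ge0.
  move=> y _; rewrite indicE; case: (y \in _) (@mem_set _ [set y0] y) (@set_mem _ [set y0] y).
    by move=> _ /(_ isT) ->; rewrite mule1.
  by rewrite mule0 lee_fin expR_ge0.
have A1 : 1 <= A by rewrite /A ler_pdivlMr//; lra.
have rc : 2 <= p * expR (r * c).
  rewrite -ler_pdivrMl// mulrC -/A (_ : r * c = A); last first.
    by rewrite /r /A invfM mulrA mulfVK// gt_eqF.
  by rewrite (le_trans _ (expR_ge1Dx _))// lerDr.
pose u s := if 0 < s then C * (A - expR (- (r * s))) else - s.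
have u0 s : 0 <= u s.
  rewrite /u; case: ltP => s0; last by rewrite oppr_ge0.
  rewrite mulr_ge0// subr_ge0 (le_trans _ A1)// expR_le1 oppr_le0.
  by rewrite mulr_ge0// ltW.
have u_le s : u s <= C * A + r^-1 * expR (- (r * s)).
  rewrite /u; case: ltP => s0.
    rewrite mulrBr lerD2l; apply: (@le_trans _ _ 0).
      by rewrite oppr_le0 mulr_ge0 ?expR_ge0.
    by rewrite mulr_ge0 ?expR_ge0// invr_ge0 ltW.
  rewrite -[leLHS]add0r lerD//; first by rewrite mulr_ge0//; lra.
  rewrite -ler_pdivrMl ?invr_gt0// invrK mulrN.
  by rewrite (le_trans _ (expR_ge1Dx _))// lerDr.
pose V x := (u (dot f (embed x)) * E a x)%:E.
have V0 x : (0 <= V x)%E by rewrite lee_fin mulr_ge0 ?expR_ge0.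
move=> x Dx; apply: (@le_lt_trans _ _ (V x)); last exact: ltry.
move: x Dx; apply: superharmonic_exit_bound => //.
- move=> x _; rewrite funenegE /= /w.
  have [s0|s0] := ltP 0 (dot f (embed x)).
    by rewrite max_r// lee_fin oppr_le0 mulr_ge0 ?expR_ge0// ltW.
  rewrite max_l; last by rewrite lee_fin oppr_ge0 mulr_le0_ge0 ?expR_ge0.
  by rewrite lee_fin /u ltNge s0/= mulNr.
move=> x [fx gx]; set s := dot f (embed x) in fx *.
(* The gain that the step y0 brings over the crude majorant u_le. *)
pose kappa := if s <= c then C * A else C * expR (- (r * (s - c))).
have kappa0 : 0 <= kappa by rewrite /kappa; case: ifP => _; rewrite mulr_ge0 ?expR_ge0//; lra.
have kappa_p : 2 * C * expR (- (r * s)) <= kappa * p.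
  rewrite /kappa; have [sc|sc] := leP s c.
    rewrite -[leRHS]mulrA Ap [C * 2]mulrC ler_piMr ?mulr_ge0//.
    by rewrite expR_le1 oppr_le0 mulr_ge0// ltW.
  rewrite (_ : - (r * (s - c)) = r * c + - (r * s)); last by ring.
  rewrite expRD [leRHS](_ : _ = (p * expR (r * c)) * (C * expR (- (r * s)))); last by ring.
  by rewrite -mulrA ler_wpM2r// mulr_ge0 ?expR_ge0.
have key (y : lattice) : (V (x + y)%R + (kappa * E a (x + y0))%:E * (\1_[set y0] y)%:E <=
    ((C * A) * E a (x + y))%:E + (r^-1 * E (a - r *: f)%R (x + y)%R)%:E)%E.
  set t := dot f (embed (x + y)).
  have EE : E (a - r *: f) (x + y) = E a (x + y) * expR (- (r * t)).
    by rewrite /E dotDl -scaleNr dotZl mulNr expRD.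
  have bound (k : R) : u t + k <= C * A + r^-1 * expR (- (r * t)) ->
      u t * E a (x + y) + k * E a (x + y) <=
      C * A * E a (x + y) + r^-1 * E (a - r *: f) (x + y).
    move=> h; rewrite EE -mulrDl [leRHS](_ : _ = E a (x + y) *
      (C * A + r^-1 * expR (- (r * t)))); last by ring.
    by rewrite mulrC ler_pM2l ?expR_gt0.
  rewrite -EFinM -!EFinD lee_fin indicE.
  have [e|ny] := eqVneq y y0; last first.
    rewrite memNset; last by move=> /= yy; rewrite yy eqxx in ny.
    by have := bound 0; rewrite mul0r mulr0 !addr0; apply.
  subst y; rewrite mem_set//= mulr1; apply: bound; rewrite /t.
  have -> : dot f (embed (x + y0)) = s - c by rewrite dot_embedD -/s /c opprK.
  rewrite /u /kappa; have [sc|sc] := leP s c.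
    rewrite ltNge subr_le0 sc /= addrC lerD2l -ler_pdivrMl ?invr_gt0// invrK mulrN.
    by rewrite (le_trans _ (expR_ge1Dx _))// lerDr.
  by rewrite subr_gt0 sc mulrBr subrK lerDl mulr_ge0 ?expR_ge0// invr_ge0 ltW.
have EE0 b y : (0 <= (E b y)%:E)%E by rewrite lee_fin expR_ge0.
have kE0 : 0 <= kappa * E a (x + y0) by rewrite mulr_ge0 ?expR_ge0.
have ind0 y : (0 <= (kappa * E a (x + y0))%:E * (\1_[set y0] y)%:E)%E.
  by rewrite -EFinM lee_fin mulr_ge0.
have CA0 : 0 <= C * A by rewrite mulr_ge0//; lra.
have r1 : 0 <= r^-1 by rewrite invr_ge0 ltW.
have : (step_mean gamma V x + (kappa * E a (x + y0))%:E * gamma [set y0] <=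
    (C * A * E a x)%:E + (r^-1 * (psi * E (a - r *: f)%R x))%:E)%E.
  have <- : (\int[gamma]_y ((C * A)%:E * (E a (x + y)%R)%:E))%E = (C * A * E a x)%:E.
    rewrite ge0_integralZl//.
    by have := step_mean_exp phi_fin a x; rewrite /step_mean => ->; rewrite phi1 mul1r.
  have <- : (\int[gamma]_y (r^-1%:E * (E (a - r *: f)%R (x + y)%R)%:E))%E =
      (r^-1 * (psi * E (a - r *: f)%R x))%:E.
    rewrite ge0_integralZl//.
    by have := step_mean_exp phi_fin (a - r *: f) x; rewrite /step_mean => ->.
  rewrite -integral_point_mass// /step_mean -!ge0_integralD//.
  - by apply: ge0_le_integral => // y _; rewrite ?adde_ge0// -!EFinM key.
  - by move=> y _; rewrite mule_ge0.
  - by move=> y _; rewrite mule_ge0.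
rewrite -(fineK gfin) -EFinM -EFinD -leeBrDr// => /le_trans; apply.
rewrite -EFinB lee_fin /V /u fx.
have -> : kappa * E a (x + y0) * fine (gamma [set y0]) = kappa * p * E a x.
  by rewrite pE /E dot_embedD expRD; ring.
have -> : r^-1 * (psi * E (a - r *: f) x) = E a x * (C * expR (- (r * s))).
  by rewrite /E dotDl -scaleNr dotZl mulNr expRD CE; ring.
have -> : C * A * E a x + E a x * (C * expR (- (r * s))) - kappa * p * E a x =
  (C * A + C * expR (- (r * s)) - kappa * p) * E a x by ring.
rewrite ler_wpM2r ?expR_ge0// -/s; lra.
Qed.

End boundary.

(** * The direction of the drift selects the case *)

Section two_cases.
Context {R : realType} {d : measure_display} {Omega : measurableType d}.
Context (P : probability Omega R) (X : nat -> {RV P >-> lattice}).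
Variables (gamma : probability lattice R) (K : set (R * R)).
Hypotheses (hX : iid_steps X gamma) (irr : killed_irreducible X K).
Hypothesis phi_fin : forall b : R * R, (phi_ext gamma b < +oo)%E.
Variable a : R * R.
Hypothesis phi1 : phi gamma a = 1.

(** The three assertions to prove, for a general weight [w]. *)
Definition positive_harmonic_correction (w : lattice -> R) : Prop :=
  let hw z := w z - \int[P]_(u in exits X K z) w (walk_tau X K z u) in
  [/\ forall z, K (embed z) ->
        P.-integrable (exits X K z) (fun u => (w (walk_tau X K z u))%:E),
      forall z, K (embed z) -> 0 < hw z & killed_harmonic X K hw].

Lemma boundary_case (f g : R * R) :
  (forall v, K v <-> 0 < dot f v /\ 0 < dot g v) ->
  irreducible_walk X -> dot f f = 1 ->
  dot (exp_mean gamma a) f = 0 -> 0 < dot (exp_mean gamma a) g ->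
  positive_harmonic_correction (fun x => dot f (embed x) * expR (dot a (embed x))).
Proof.
move=> KP irrX ff mf mg; have [y0 y0_pos y0_neg] := exists_negative_step hX irrX ff.
have DE : [set x | K (embed x)] =
    [set x : lattice | 0 < dot f (embed x) /\ 0 < dot g (embed x)].
  by apply/seteqP; split => x /KP.
apply: (positive_harmonic hX irr); rewrite DE.
- by move=> x [fx _]; rewrite mulr_gt0 ?expR_gt0.
- by move=> x _; exact: boundary_harmonic.
- move=> x Dx; have [C _ [v _ b]] := boundary_positive_part phi_fin phi1 mf mg Dx.
  by rewrite (le_lt_trans (b x Dx))// ltry.
- exact: (boundary_negative_part phi_fin phi1 y0_pos y0_neg).
- by move=> z; exact: (boundary_deep phi_fin phi1 mf mg).
Qed.

Lemma interior_case (f g : R * R) :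
  (forall v, K v <-> 0 < dot f v /\ 0 < dot g v) ->
  0 < dot (exp_mean gamma a) f -> 0 < dot (exp_mean gamma a) g ->
  positive_harmonic_correction (fun x => expR (dot a (embed x))).
Proof.
move=> KP mf mg.
have DE : [set x | K (embed x)] =
    [set x : lattice | 0 < dot f (embed x) /\ 0 < dot g (embed x)].
  by apply/seteqP; split => x /KP.
apply: (positive_harmonic hX irr); rewrite DE.
- by move=> x _; exact: expR_gt0.
- by move=> x _; exact: interior_harmonic.
- move=> x Dx; have [t [s [_ _ b]]] := interior_bounds phi_fin phi1 mf mg.
  by rewrite (le_lt_trans (b x Dx))// ltry.
- by move=> x _; rewrite interior_nonneg.
- by move=> z; exact: (interior_deep phi_fin phi1 mf mg).
Qed.

End two_cases.

Theorem proposition1 (R : realType) (d : measure_display)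
    (Omega : measurableType d) (P : probability Omega R)
    (X : nat -> {RV P >-> lattice}) (gamma : probability lattice R)
    (c1 c2 f1 f2 : R * R)
    (hX : iid_steps X gamma)
    (hc1 : unit_circle c1) (hc2 : unit_circle c2)
    (hangle : 0 < angle c1 c2 < pi)
    (hf1 : inward_normal (open_cone c1 c2) c1 f1)
    (hf2 : inward_normal (open_cone c1 c2) c2 f2)
    (A1_irreducible : irreducible_walk X)
    (A1_drift : drift gamma <> (0, 0))
    (A2 : killed_irreducible X (open_cone c1 c2))
    (A3 : forall a : R * R, (phi_ext gamma a < +oo)%E)
    (A4_1 : aperiodic_projection X f1)
    (A4_2 : aperiodic_projection X f2)
    (a : R * R) (a_in_Gamma : Gamma gamma (open_cone c1 c2) a) :
  let K := open_cone c1 c2 in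
  let h_a := h X K gamma c1 c2 f1 f2 a in
  [/\ (* the expectation that defines h_a exists *)
      forall z : lattice, K (embed z) ->
        P.-integrable (exits X K z)
          (fun w => (weight K gamma c1 c2 f1 f2 a (walk_tau X K z w))%:E),
      forall z : lattice, K (embed z) -> 0 < h_a z
    & killed_harmonic X K h_a].
Proof.
move=> K h_a; have [a_bd qa] := a_in_Gamma.
have phi1 := phi_boundary A3 a_bd.
have [p1 p2] := normal_dot_gt0 hf1 hf2.
have [/unit_circleP f11 f1c1 _] := hf1; have [/unit_circleP f22 f2c2 _] := hf2.
have KP v : K v <-> 0 < dot f1 v /\ 0 < dot f2 v.
  by rewrite ![dot _ v]dotC; exact: open_coneP.
have KP' v : K v <-> 0 < dot f2 v /\ 0 < dot f1 v.
  by split=> [/KP[]|[v2 v1]]; [|apply/KP].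
pose m := exp_mean gamma a; pose N := enorm m.
have qE : q gamma a = N^-1 *: m by rewrite /q gradient_phi.
have N0 : 0 < N.
  rewrite lt_neqAle sqrtr_ge0 andbT; apply/eqP => N0.
  have [_ /unit_circleP] := qa.
  by rewrite qE -N0 invr0 scale0r /dot /= !mulr0 addr0 => /eqP; rewrite eq_sym oner_eq0.
have mE v : dot m v = N * dot v (q gamma a).
  by rewrite qE dotZr mulrA divff ?gt_eqF// mul1r dotC.
suff : positive_harmonic_correction X K (weight K gamma c1 c2 f1 f2 a) by [].
have [q1|nq1] := eqVneq (q gamma a) c1.
  have -> : weight K gamma c1 c2 f1 f2 a =
      (fun x => dot f1 (embed x) * expR (dot a (embed x))).
    by apply/funext => x; rewrite /weight q1 eqxx dotC.
  apply: (boundary_case hX A2 A3 phi1 KP) => //; rewrite mE q1.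
    by rewrite f1c1 mulr0.
  by rewrite mulr_gt0.
have [q2|nq2] := eqVneq (q gamma a) c2.
  have -> : weight K gamma c1 c2 f1 f2 a =
      (fun x => dot f2 (embed x) * expR (dot a (embed x))).
    by apply/funext => x; rewrite /weight (negbTE nq1) q2 eqxx dotC.
  apply: (boundary_case hX A2 A3 phi1 KP') => //; rewrite mE q2.
    by rewrite f2c2 mulr0.
  by rewrite mulr_gt0.
have qK : int_Sigma K (q gamma a).
  by case: (Sigma_cases hc1 hc2 hf1 hf2 qa) => // qc; [case/eqP: nq1|case/eqP: nq2].
have -> : weight K gamma c1 c2 f1 f2 a = (fun x => expR (dot a (embed x))).
  apply/funext => x; rewrite /weight (negbTE nq1) (negbTE nq2).
  by case: asboolP.
have [/KP[q1 q2] _] := qK.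
by apply: (interior_case hX A2 A3 phi1 KP); rewrite mE mulr_gt0.
Qed.
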